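(* Let $G$ be a $K_{3,3}$-minor free graph of order $n\geq 1186$. Then $q(G)\leq q(F_{3,3}(n))$, with equality if and only if $G=F_{3,3}(n)$. Here, writing $n-2=3p+r$ with integers $p\ge0$ and $0\le r<3$, $q(F_{3,3}(n))$ is the largest root of the equation $$x^3-(n+2r+6)x^2+(12r+4n+2rn+4)x+4r-8rn-4r^2=0.$$
   Context: All graphs are finite, simple and undirected. For a graph $G$, $Q(G)=D(G)+A(G)$ is the signless Laplacian matrix ($D(G)$ the diagonal degree matrix, $A(G)$ the adjacency matrix), and $q(G)$ denotes its largest eigenvalue. A graph $H$ is a minor of $G$ if $H$ can be obtained from $G$ by deleting edges, contracting edges, or deleting vertices; $G$ is $H$-minor free if it has no minor isomorphic to $H$. $K_{s,t}$ is the complete bipartite graph with parts of sizes $s$ and $t$, and $K_m$ the complete graph on $m$ vertices. $G\cup H$ is disjoint union, $G\vee H$ is the join, and $k\cdot G$ is the disjoint union of $k$ copies of $G$. For $2\le s\le t$, write $n-s+1=pt+r$ with $0\le r<t$, and set $F_{s,t}(n):=K_{s-1}\vee(p\cdot K_t\cup K_r)$ (where $K_0$ is the empty graph); in particular $F_{3,3}(n)=K_2\vee(p\cdot K_3\cup K_r)$ with $n-2=3p+r$. *)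

(* Defs.v *)
From HB Require Import structures.
From Stdlib Require Import Relations.
From mathcomp Require Import all_boot all_order all_algebra all_fingroup.
From mathcomp.real_closed Require Import polyrcf.
From mathcomp Require Import reals.
Set Implicit Arguments. Unset Strict Implicit. Unset Printing Implicit Defensive.
Import Order.TTheory GRing.Theory Num.Theory.
Local Open Scope ring_scope.

Definition simple_graph (n : nat) (e : rel 'I_n) : Prop :=
  symmetric e /\ irreflexive e.

Definition deg (n : nat) (e : rel 'I_n) (i : 'I_n) : nat := #|[set j | e i j]|.

Definition degmx (R : nzRingType) (n : nat) (e : rel 'I_n) : 'M[R]_n :=
  \matrix_(i, j) (if i == j then (deg e i)%:R else 0).
Definition adjmx (R : nzRingType) (n : nat) (e : rel 'I_n) : 'M[R]_n :=
  \matrix_(i, j) (e i j)%:R.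
Definition signlessQ (R : nzRingType) (n : nat) (e : rel 'I_n) : 'M[R]_n :=
  degmx R e + adjmx R e.

(* largest eigenvalue of a real square matrix whose eigenvalues are real:
   the maximum of the (real) roots of its characteristic polynomial.
   (For Q(G) all eigenvalues are real and >= 0, and for n >= 1 there is at
   least one, so the default 0 of the max is harmless.) *)
Definition lambda_max (R : rcfType) (n : nat) (A : 'M[R]_n) : R :=
  \big[Num.max/0]_(x <- rootsR (char_poly A)) x.

Definition q_index (R : rcfType) (n : nat) (e : rel 'I_n) : R :=
  lambda_max (signlessQ R e).

Definition graph_iso (n : nat) (e1 e2 : rel 'I_n) : Prop :=
  exists s : 'S_n, forall i j, e1 i j = e2 (s i) (s j).

(* ---- Minors, via the paper's operations (vertex deletion, edge deletion,
   edge contraction).  Intermediate graphs live inside the ambient vertex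
   type 'I_n: a state is a vertex set V together with an edge relation E
   (only its restriction to V matters; the operations keep E inside V). *)
Definition gstate (n : nat) : Type := ({set 'I_n} * rel 'I_n)%type.

Inductive minor_step (n : nat) : gstate n -> gstate n -> Prop :=
| del_vertex (V : {set 'I_n}) (E : rel 'I_n) (v : 'I_n) :
    v \in V ->
    minor_step (V, E) (V :\ v, fun x y => [&& E x y, x != v & y != v])
| del_edge (V : {set 'I_n}) (E : rel 'I_n) (u v : 'I_n) :
    u \in V -> v \in V -> E u v ->
    minor_step (V, E)
      (V, fun x y => E x y && ~~ (((x == u) && (y == v)) || ((x == v) && (y == u))))
| contract_edge (V : {set 'I_n}) (E : rel 'I_n) (u v : 'I_n) :
    u \in V -> v \in V -> E u v ->
    (* contract uv into u (simple graph: loops and multiple edges dropped) *)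
    minor_step (V, E)
      (V :\ v, fun x y =>
         [&& x != v, y != v, x != y &
             [|| E x y, (x == u) && E v y | (y == u) && E x v]]).

Definition is_minor (m : nat) (h : rel 'I_m) (n : nat) (e : rel 'I_n) : Prop :=
  exists (V : {set 'I_n}) (E : rel 'I_n),
    clos_refl_trans (gstate n) (@minor_step n) (setT, e) (V, E) /\
    exists f : 'I_m -> 'I_n,
      injective f /\ (forall x, x \in V <-> exists i, f i = x) /\
      (forall i j, E (f i) (f j) = h i j).

Definition K33 : rel 'I_6 := fun i j => (i < 3)%N != (j < 3)%N.

(* F_{3,3}(n) = K_2 \/ (p.K_3 \u K_r), n - 2 = 3p + r, on 'I_n:
   vertices 0,1 form the K_2 joined to everything; vertices i >= 2 are
   grouped into blocks by (i-2) %/ 3 (p blocks of size 3, one of size r). *)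
Definition F33 (n : nat) : rel 'I_n := fun i j =>
  (i != j) && [|| (i < 2)%N, (j < 2)%N | ((i - 2) %/ 3 == (j - 2) %/ 3)%N].

Arguments F33 n i j : clear implicits.

Definition cubicF (R : nzRingType) (n r : nat) (x : R) : R :=
  x ^+ 3 - (n%:R + 2 * r%:R + 6) * x ^+ 2
  + (12 * r%:R + 4 * n%:R + 2 * r%:R * n%:R + 4) * x
  + 4 * r%:R - 8 * r%:R * n%:R - 4 * r%:R ^+ 2.

(* Main.v *)
(* Write q for q(G) and let rho > n + 2 be the largest root of the cubic.  The
   graph F_{3,3}(n) has a positive eigenvector for rho, constant on its three
   kinds of vertices, so q(F_{3,3}(n)) = rho; it remains to show that q >= rho
   forces G to be F_{3,3}(n).
   A K_{3,3}-minor free graph has fewer than 4n edges (Mader's contraction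
   argument).  If x is an eigenvector for q and y = |x| is scaled to have maximum
   1, then (q - d(w)) y_w <= sum of y over N(w).  Summing gives sum y <= 16,
   hence a vertex v of degree at least n - 12; as three vertices have at most
   two common neighbours, all vertices but v and one other vertex u have degree
   about n/2 at most, hence weight O(1/n), and the inequalities at u and v leave
   only the possibility that u and v are dominating.
   On the other vertices the induced graph L has maximum degree at most 2, and
   solving the eigenvector equation shows that q >= rho bounds the weighted
   deficiency, the sum of (2 - d_L(w)) z_w, by 2/(q - 4).  So the vertices of
   degree less than 2 in L are none, a single vertex or two adjacent ones, and a
   2-regular component other than a triangle would give a K_{3,3} minor. *)

Require Import Defs.
From Stdlib Require Import Relations.
From mathcomp Require Import all_boot all_order all_algebra all_fingroup.
From mathcomp.real_closed Require Import polyrcf.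
From mathcomp Require Import reals.
From mathcomp Require Import zify ring lra.
Set Implicit Arguments. Unset Strict Implicit. Unset Printing Implicit Defensive.
Import Order.TTheory GRing.Theory Num.Theory.
Local Open Scope ring_scope.

(** * Minors *)

(** Allowing any starting state lets inductions pass through intermediate minors; at [(setT, e)]
    this unfolds to [is_minor K33 e]. *)
Definition has_K33 (n : nat) (s : gstate n) : Prop :=
  exists (V : {set 'I_n}) (E : rel 'I_n),
    clos_refl_trans (gstate n) (@minor_step n) s (V, E) /\
    exists f : 'I_6 -> 'I_n,
      injective f /\ (forall x, x \in V <-> exists i, f i = x) /\
      (forall i j, E (f i) (f j) = K33 i j).

Lemma has_K33_step (n : nat) (s s' : gstate n) :
  minor_step s s' -> has_K33 s' -> has_K33 s.
Proof.
move=> st [V [E [R f]]]; exists V, E; split=> //.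
by apply: rt_trans R; apply: rt_step.
Qed.

(** Induction on the number of vertices plus ordered edges: delete a vertex outside the image of
    [f], or else an edge with no counterpart in [K33]. When neither is left, the state is an exact
    copy. *)
Lemma K33_subgraph (n : nat) (f : 'I_6 -> 'I_n) (V : {set 'I_n}) (E : rel 'I_n) :
  injective f -> symmetric E -> irreflexive E -> (forall i, f i \in V) ->
  (forall i j, K33 i j -> E (f i) (f j)) -> has_K33 (V, E).
Proof.
move=> finj.
have [m] := ubnP (#|V| + #|[set p : 'I_n * 'I_n | E p.1 p.2]|)%N.
elim: m V E => // m IHm V E; rewrite ltnS => le_m symE irrE fV fE.
case: (boolP [exists v in V, [forall i, f i != v]]) => [/existsP[v /andP[vV /forallP fv]]|nov].
  apply: (has_K33_step (del_vertex E vV)); apply: IHm.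
  - apply: leq_trans le_m; rewrite -addSn leq_add //.
      by rewrite (cardsD1 v V) vV.
    apply: subset_leq_card; apply/subsetP=> p; rewrite !inE /=.
    by case/and3P.
  - by move=> x y; rewrite symE; case: (E y x) => //=; rewrite andbC.
  - by move=> x; rewrite irrE.
  - by move=> i; rewrite !inE fv fV.
  - by move=> i j ij; rewrite fE // !fv.
have Vf x : x \in V <-> exists i, f i = x.
  split=> [xV|[i <-]]; last exact: fV.
  move: nov; rewrite negb_exists => /forallP/(_ x); rewrite xV /= negb_forall.
  by case/existsP=> i /negPn/eqP; exists i.
case: (boolP [exists i, exists j, E (f i) (f j) && ~~ K33 i j]).
  case/existsP=> i /existsP[j /andP[Eij nij]].
  apply: (has_K33_step (del_edge (fV i) (fV j) Eij)); apply: IHm => //.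
  - apply: leq_trans le_m; rewrite -addnS leq_add //.
    apply: proper_card; apply/properP; split.
      by apply/subsetP=> p; rewrite !inE /= => /andP[].
    by exists (f i, f j); rewrite !inE /= ?Eij ?eqxx.
  - by move=> x y; rewrite symE orbC (andbC (x == _)) (andbC (x == f i)).
  - by move=> x; rewrite irrE.
  - move=> i' j' ij'; rewrite fE //= !(inj_eq finj); apply: contra nij.
    by case/orP=> /andP[/eqP<- /eqP<-] //; move: ij'; rewrite /K33 eq_sym.
move=> noe; exists V, E; split; first exact: rt_refl.
exists f; split=> //; split=> // i j; apply/idP/idP; last exact: fE.
move=> Eij; apply: contraNT noe => nij.
by apply/existsP; exists i; apply/existsP; exists j; rewrite Eij.
Qed.

Lemma K33_of_seqs (n : nat) (A B : seq 'I_n) (V : {set 'I_n}) (E : rel 'I_n) :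
  symmetric E -> irreflexive E -> size A = 3 -> size B = 3 -> uniq A -> uniq B ->
  {subset A <= V} -> {subset B <= V} -> allrel E A B -> has_K33 (V, E).
Proof.
move=> symE irrE sA sB uA uB AV BV /allrelP EAB.
have [x0 x0A] : exists x, x \in A.
  by case: A sA {uA AV EAB} => // a A _; exists a; rewrite inE eqxx.
have sAB : size (A ++ B) = 6 by rewrite size_cat sA sB.
have uAB : uniq (A ++ B).
  rewrite cat_uniq uA uB andbT /=; apply/hasPn => b bB; apply/negP => bA.
  by have := EAB _ _ bA bB; rewrite irrE.
pose f (i : 'I_6) := nth x0 (A ++ B) i.
have fA (i : 'I_6) : (i < 3)%N -> f i \in A.
  by move=> i3; rewrite /f nth_cat sA i3 mem_nth ?sA.
have fB (i : 'I_6) : ~~ (i < 3)%N -> f i \in B.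
  move=> i3; rewrite /f nth_cat sA (negPf i3) mem_nth ?sB //.
  by case: i i3 => i /= *; lia.
apply: (@K33_subgraph _ f) => //.
- move=> i j /eqP; rewrite nth_uniq ?sAB // => /eqP; exact: val_inj.
- move=> i; case: (boolP (i < 3)%N) => i3; first exact/AV/fA.
  exact/BV/fB.
move=> i j; rewrite /K33.
case: (boolP (i < 3)%N) => i3; case: (boolP (j < 3)%N) => j3 // _.
  by apply: EAB; [apply: fA | apply: fB].
by rewrite symE; apply: EAB; [apply: fA | apply: fB].
Qed.

Lemma card_gt2_seq (n : nat) (S : {set 'I_n}) : (2 < #|S|)%N ->
  exists B : seq 'I_n, [/\ size B = 3, uniq B & {subset B <= S}].
Proof.
move=> S3; exists (take 3 (enum S)); split.
- by rewrite size_takel // -cardE.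
- by rewrite take_uniq ?enum_uniq.
- by move=> x /mem_take; rewrite mem_enum.
Qed.

Lemma K33_common_nbrs (n : nat) (V : {set 'I_n}) (E : rel 'I_n) (x y z : 'I_n) :
  symmetric E -> irreflexive E -> uniq [:: x; y; z] ->
  x \in V -> y \in V -> z \in V ->
  (2 < #|[set w in V | [&& E x w, E y w & E z w]]|)%N -> has_K33 (V, E).
Proof.
move=> symE irrE uA xV yV zV /card_gt2_seq[B [sB uB BS]].
apply: (@K33_of_seqs _ [:: x; y; z] B) => //.
- by move=> w; rewrite !inE => /or3P[]/eqP->.
- by move=> w /BS; rewrite inE => /andP[].
apply/allrelP => a b aA /BS; rewrite inE => /and4P[_ xb yb zb].
by move: aA; rewrite !inE => /or3P[]/eqP->.
Qed.

(** * The number of edges *)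

Definition nbrs (n : nat) (V : {set 'I_n}) (E : rel 'I_n) (x : 'I_n) : {set 'I_n} :=
  [set y in V | E x y].

Definition degsum (n : nat) (V : {set 'I_n}) (E : rel 'I_n) : nat :=
  (\sum_(x in V) #|nbrs V E x|)%N.

Lemma card_nbrs (n : nat) (V : {set 'I_n}) (E : rel 'I_n) x :
  #|nbrs V E x| = (\sum_(y in V) E x y)%N.
Proof.
rewrite /nbrs -sum1dep_card big_mkcondr /=.
by apply: eq_bigr => y _; case: (E x y).
Qed.

(** Written as double sums, the gains and losses at the vertex [u] can be compared with a degree sum
    pair by pair. *)
Lemma sum_pairs1 (n : nat) (W X : {set 'I_n}) u : u \in W -> X \subset W ->
  (\sum_(x in W) \sum_(y in W) ((x == u) && (y \in X)) = #|X|)%N.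
Proof.
move=> uW XW; rewrite (big_setD1 u uW) /= [X in (_ + X)%N]big1 ?addn0 => [|x]; last first.
  by rewrite !inE => /andP[/negPf-> _]; rewrite big1.
rewrite eqxx /= -[in RHS](setIidPr XW) -sum1_card.
rewrite [RHS](eq_bigl (fun y => (y \in W) && (y \in X))) => [|y]; last by rewrite inE.
by rewrite [RHS]big_mkcondr; apply: eq_bigr => y _; case: (y \in X).
Qed.

Lemma sum_pairs2 (n : nat) (W X : {set 'I_n}) u : u \in W -> X \subset W ->
  (\sum_(x in W) \sum_(y in W) ((y == u) && (x \in X)) = #|X|)%N.
Proof. by move=> uW XW; rewrite exchange_big /= sum_pairs1. Qed.

Lemma degsum_del_vertex (n : nat) (V : {set 'I_n}) (E : rel 'I_n) v :
  symmetric E -> irreflexive E -> v \in V ->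
  (degsum V E = degsum (V :\ v) E + 2 * #|nbrs V E v|)%N.
Proof.
move=> symE irrE vV; rewrite /degsum (big_setD1 v vV) /=.
under eq_bigr => x _ do rewrite card_nbrs (big_setD1 v vV) /= -card_nbrs.
rewrite big_split /=.
have -> : (\sum_(x in V :\ v) E x v = #|nbrs V E v|)%N.
  rewrite card_nbrs (big_setD1 v vV) /= irrE add0n.
  by apply: eq_bigr => x _; rewrite symE.
by rewrite addnA addnn mul2n addnC.
Qed.

Lemma degsum_del_edge (n : nat) (V : {set 'I_n}) (E : rel 'I_n) u v :
  u \in V -> v \in V ->
  (degsum V E <= degsum V (fun x y => E x y &&
     ~~ (((x == u) && (y == v)) || ((x == v) && (y == u)))) + 2)%N.
Proof.
move=> uV vV; rewrite /degsum.
have H1 := @sum_pairs1 _ V [set v] u uV; have H2 := @sum_pairs2 _ V [set v] u uV.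
rewrite !cards1 !sub1set in H1 H2; rewrite -[2%N]/(1 + 1)%N -{1}(H1 vV) -(H2 vV).
rewrite -!big_split /=; apply: leq_sum => x _.
rewrite !card_nbrs -!big_split /=; apply: leq_sum => y _.
rewrite !inE (andbC (x == v)); case: (E x y) => //=.
by case: (_ && _); case: (_ && _).
Qed.

Lemma degsum_contract (n : nat) (V : {set 'I_n}) (E : rel 'I_n) u v :
  symmetric E -> irreflexive E -> u \in V -> v \in V -> E u v ->
  (degsum V E <= degsum (V :\ v) (fun x y =>
     [&& x != v, y != v, x != y & [|| E x y, (x == u) && E v y | (y == u) && E x v]])
     + 2 * (#|[set w in V | E u w && E v w]| + 1))%N.
Proof.
move=> symE irrE uV vV uv; rewrite (degsum_del_vertex symE irrE vV).
have neuv : u != v by apply: contraTneq uv => ->; rewrite irrE.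
(* [X] consists of the vertices that become new neighbours of [u]. Only the edge uv and one edge for
   each common neighbour in [C] are lost. *)
set C := [set w in V | _]; pose X := nbrs V E v :\: (u |: C).
have XW : X \subset V :\ v.
  apply/subsetP=> x; rewrite !inE => /and3P[_ -> Evx]; rewrite andbT.
  by apply: contraTneq Evx => ->; rewrite irrE.
have uW : u \in V :\ v by rewrite !inE neuv.
have -> : #|nbrs V E v| = (#|X| + (#|C| + 1))%N.
  rewrite -(cardsID (u |: C) (nbrs V E v)) addnC; congr (_ + _)%N.
  rewrite (setIidPr _) ?cardsU1 ?inE ?irrE ?andbF /= 1?addnC //.
  apply/subsetP=> x; rewrite !inE => /orP[/eqP->|/and3P[-> _ ->]//].
  by rewrite uV symE.
rewrite mulnDr addnA leq_add2r mul2n -addnn addnA.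
rewrite -{1}(sum_pairs1 uW XW) -(sum_pairs2 uW XW) /degsum.
rewrite -!big_split /=; apply: leq_sum => x; rewrite !inE => /andP[xv xV].
rewrite !card_nbrs -!big_split /=; apply: leq_sum => y; rewrite !inE => /andP[yv yV].
rewrite xv yv xV yV /=.
have [<-|nexy] := eqVneq x y; first by rewrite irrE /=; case: (x == u) => //=; rewrite andbF.
case: (eqVneq x u) nexy => [->|xu] nexy /=.
  rewrite (eq_sym y u) (negPf nexy) uv /=.
  by case: (E u y); case: (E v y).
case: (eqVneq y u) => [->|yu] /=; last by case: (E x y).
by rewrite (symE x u) (symE x v); case: (E u x); case: (E v x).
Qed.

(** If y, z in N(x) are not adjacent, each has at least 4 neighbours among the at most 5 other
    vertices of N(x), so they share 3. If N(x) is a clique, any two of its vertices share the at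
    least 3 others. In both cases x, y, z have three common neighbours. *)
Lemma K33_dense_nbhd (n : nat) (V : {set 'I_n}) (E : rel 'I_n) x :
  symmetric E -> irreflexive E -> x \in V ->
  (4 < #|nbrs V E x| < 8)%N ->
  (forall y, y \in nbrs V E x -> 3 < #|[set w in V | E x w && E y w]|)%N ->
  has_K33 (V, E).
Proof.
move=> symE irrE xV /andP[N4 N8] Hy; set N := nbrs V E x in N4 N8 Hy.
have NV y : y \in N -> y \in V by rewrite inE => /andP[].
have Nx y : y \in N -> E x y by rewrite inE => /andP[].
suff [y [z [yN zN neyz cyz]]] : exists y z, [/\ y \in N, z \in N, y != z &
    (2 < #|[set w in V | [&& E x w, E y w & E z w]]|)%N].
  apply: (@K33_common_nbrs _ V E x y z) => //; rewrite ?NV //=.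
  have xN w : w \in N -> x != w by move/Nx; apply: contraTneq => <-; rewrite irrE.
  by rewrite !inE neyz negb_or !xN.
case: (boolP [exists y in N, exists z in N, (y != z) && ~~ E y z]).
  case/existsP=> y /andP[yN /existsP[z /andP[zN /andP[yz nE]]]].
  exists y, z; split=> //.
  set A := [set w in V | E x w && E y w]; set B := [set w in V | E x w && E z w].
  have -> : [set w in V | [&& E x w, E y w & E z w]] = A :&: B.
    by apply/setP=> w; rewrite !inE; case: (w \in V); case: (E x w); case: (E y w).
  have := Hy _ yN; have := Hy _ zN; rewrite -/A -/B.
  have : (#|A :|: B| <= #|N :\ y :\ z|)%N.
    apply: subset_leq_card; apply/subsetP=> w; rewrite !inE.
    case: (eqVneq w z) => [->|_]; first by rewrite irrE (negPf nE) !andbF.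
    case: (eqVneq w y) => [->|_]; first by rewrite (symE z y) irrE (negPf nE) !andbF.
    by case/orP=> /and3P[-> -> _].
  have := cardsD1 y N; have := cardsD1 z (N :\ y); have := cardsUI A B.
  rewrite yN in_setD1 (eq_sym z) yz zN /=.
  clear -N4 N8; move: N4 N8; move: #|A| #|B| #|A :|: B| #|A :&: B| #|N :\ y :\ z| #|N :\ y| #|N|; lia.
rewrite negb_exists_in => /forall_inP clique.
have adj a b : a \in N -> b \in N -> b != a -> E a b.
  move=> aN bN ba; have := clique _ aN; rewrite negb_exists_in => /forall_inP/(_ _ bN).
  by rewrite eq_sym ba negbK.
have [|B [sB uB BN]] := @card_gt2_seq _ N; first lia.
case: B sB uB BN => // y [|z B'] // _ uB BN.
have yN : y \in N by apply: BN; rewrite inE eqxx.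
have zN : z \in N by apply: BN; rewrite !inE eqxx orbT.
have yz : y != z by move: uB; rewrite /= inE negb_or -andbA => /andP[].
exists y, z; split=> //.
have : (#|N :\ y :\ z| <= #|[set w in V | [&& E x w, E y w & E z w]]|)%N.
  apply: subset_leq_card; apply/subsetP=> w; rewrite !in_setD1 => /and3P[wz wy wN].
  by rewrite inE NV // Nx // !adj.
have := cardsD1 y N; have := cardsD1 z (N :\ y).
rewrite yN in_setD1 (eq_sym z) yz zN /=; clear -N4; move: N4.
by move: #|N :\ y :\ z| #|N :\ y| #|N|; lia.
Qed.

(* Mader's argument: in a minimal counterexample every edge lies in at least
   four triangles, so the neighbourhood of a vertex of degree at most 7 is
   dense enough to contain a K_{2,3}. *)
Lemma degsum_bound (n : nat) (V : {set 'I_n}) (E : rel 'I_n) :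
  symmetric E -> irreflexive E -> (0 < #|V|)%N -> ~ has_K33 (V, E) ->
  (degsum V E + 4 <= 8 * #|V|)%N.
Proof.
(* A lexicographic measure: at most n * n pairs are related, so losing a vertex lowers it whatever
   happens to the edges. *)
have [m] := ubnP (#|V| * (n * n).+1 + #|[set p : 'I_n * 'I_n | E p.1 p.2]|)%N.
elim: m V E => // m IHm V E; rewrite ltnS => le_m symE irrE V0 noK.
have cE (E' : rel 'I_n) : (#|[set p : 'I_n * 'I_n | E' p.1 p.2]| <= n * n)%N.
  by apply: leq_trans (max_card _) _; rewrite card_prod card_ord.
have IHv v (E' : rel 'I_n) : v \in V -> minor_step (V, E) (V :\ v, E') ->
    symmetric E' -> irreflexive E' -> (0 < #|V :\ v|)%N ->
    (degsum (V :\ v) E' + 4 <= 8 * #|V :\ v|)%N.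
  move=> vV st symE' irrE' V1; apply: IHm => //; last by move/(has_K33_step st).
  move: le_m (cE E'); rewrite (cardsD1 v V) vV mulnDl mul1n /=.
  move: #|V :\ v| #|[set p | E' p.1 p.2]| #|[set p | E p.1 p.2]| (n * n)%N => a b c d; lia.
rewrite leqNgt; apply/negP=> big.
(* Deleting such a vertex lowers the degree sum by at most 8, which the bound allows per vertex; a
   single vertex is the base case. *)
have delv v : v \in V -> (#|nbrs V E v| <= 4)%N -> False.
  move=> vV dv; have eq1 := degsum_del_vertex symE irrE vV.
  have cV := cardsD1 v V; rewrite vV /= in cV.
  have [V1|V1] := posnP #|V :\ v|.
    have e0 : nbrs V E v = set0.
      apply/setP=> y; rewrite !inE; apply/negP=> /andP[yV Evy].
      have : y \in V :\ v by rewrite !inE yV andbT; apply: contraTneq Evy => ->; rewrite irrE.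
      by rewrite (cards0_eq V1) inE.
    move: eq1; rewrite e0 cards0 /degsum (cards0_eq V1) big_set0 => eq1.
    by move: big; rewrite /degsum; lia.
  have := IHv v _ vV (del_vertex E vV).
  have -> : degsum (V :\ v) (fun x y => [&& E x y, x != v & y != v]) = degsum (V :\ v) E.
    apply: eq_bigr => x; rewrite !inE => /andP[xv xV]; apply: eq_card => y.
    by rewrite !inE xv /=; case: (y != v) => //=; rewrite andbT.
  move=> H; have {H} : (degsum (V :\ v) E + 4 <= 8 * #|V :\ v|)%N; last first.
  move: big eq1 cV dv; rewrite /degsum; move: #|V :\ v| #|nbrs V E v| #|V|; lia.
  apply: H => // [x y|x]; last by rewrite irrE.
  by rewrite symE; case: (E y x) => //=; rewrite andbC.
(* From 8|V| - 1 on, deleting one edge, which costs 2, still leaves a counterexample. Below that the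
   average degree is less than 8. *)
have [few|many] := ltnP (degsum V E) (8 * #|V| - 1).
  have [x xV dx] : exists2 x, x \in V & (#|nbrs V E x| < 8)%N.
    apply/exists_inP; apply: contraLR few; rewrite negb_exists_in => /forall_inP all8.
    rewrite -leqNgt; apply: leq_trans (leq_subr _ _) _.
    rewrite mulnC -sum_nat_const; apply: leq_sum => x xV.
    by have := all8 x xV; rewrite -leqNgt.
  have [/delv|dx4] := leqP (#|nbrs V E x|) 4; first exact.
  (* Contracting an edge in at most 3 triangles lowers the degree sum by at most 2 * (3 + 1) = 8,
     again the allowance for one vertex. *)
  case: (boolP [exists y in nbrs V E x, #|[set w in V | E x w && E y w]| <= 3])%N.
    case/existsP=> y; rewrite inE => /andP[/andP[yV xy] c3].
    have cV := cardsD1 y V; rewrite yV /= in cV.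
    have V1 : (0 < #|V :\ y|)%N.
      apply/card_gt0P; exists x; rewrite !inE xV andbT.
      by apply: contraTneq xy => ->; rewrite irrE.
    have := IHv y _ yV (contract_edge xV yV xy).
    have := degsum_contract symE irrE xV yV xy.
    move=> le1 /(_ _ _ V1) H; have {H} : (degsum (V :\ y) (fun x0 y0 =>
     [&& x0 != y, y0 != y, x0 != y0 & [|| E x0 y0, (x0 == x) && E y y0 | (y0 == x) && E x0 y]])
        + 4 <= 8 * #|V :\ y|)%N.
      apply: H => [a b|a]; last by rewrite eqxx !andbF.
      rewrite (symE b a) (symE y b) (symE a y) (eq_sym b a) andbCA.
      by rewrite (orbC ((a == x) && _)).
    move: le1 big cV c3; set d := degsum (V :\ y) _; move: d.
    by move: #|V :\ y| #|V| (degsum V E) #|[set w in V | E x w && E y w]|; lia.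
  rewrite negb_exists_in => /forall_inP H; apply: noK.
  apply: (K33_dense_nbhd symE irrE xV); first by rewrite dx4.
  by move=> y /H; rewrite -ltnNge.
have [u [v [uV vV uv]]] : exists u v, [/\ u \in V, v \in V & E u v].
  have : (0 < degsum V E)%N by lia.
  rewrite /degsum lt0n sum_nat_eq0 negb_forall_in => /exists_inP[u uV].
  by rewrite -lt0n => /card_gt0P[v]; rewrite inE => /andP[vV uv]; exists u, v.
have := degsum_del_edge E uV vV; set E' := fun _ _ => _ => dE.
have : (degsum V E' + 4 <= 8 * #|V|)%N; last by lia.
apply: IHm => //.
- apply: leq_trans le_m; rewrite -addnS leq_add2l.
  apply: proper_card; apply/properP; split.
    by apply/subsetP=> p; rewrite !inE /= => /andP[].
  by exists (u, v); rewrite !inE /= ?/E' ?uv ?eqxx.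
- by move=> x y; rewrite /E' symE orbC (andbC (x == _)) (andbC (x == u)).
- by move=> x; rewrite /E' irrE.
- by move/(has_K33_step (del_edge uV vV uv)).
Qed.

(** * Two-regular components *)

Lemma degsum_even (n : nat) (V : {set 'I_n}) (E : rel 'I_n) :
  symmetric E -> irreflexive E -> ~~ odd (degsum V E).
Proof.
move=> symE irrE; have [m] := ubnP #|V|.
elim: m V => // m IHm V; rewrite ltnS => Vm.
have [->|[v vV]] := set_0Vmem V; first by rewrite /degsum big_set0.
rewrite (degsum_del_vertex symE irrE vV) oddD mul2n odd_double addbF IHm //.
by move: Vm; rewrite (cardsD1 v) vV.
Qed.

(* Contract the inner part of the path to one vertex x; then the sides
   {u, w, x} and {v, a, b} span a K_{3,3}. *)
Lemma K33_of_path (n : nat) (V : {set 'I_n}) (E : rel 'I_n) u v w a b (s : seq 'I_n) :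
  symmetric E -> irreflexive E ->
  {subset u :: v :: w :: a :: rcons s b <= V} -> uniq (u :: v :: w :: a :: rcons s b) ->
  (forall x, x \in V -> x != u -> E u x) -> (forall x, x \in V -> x != v -> E v x) ->
  E w a -> E w b -> path E a (rcons s b) -> s != [::] -> has_K33 (V, E).
Proof.
have [m] := ubnP (size s); elim: m s V E => // m IHm [|x [|x' s]] V E //; rewrite ltnS => sm
  symE irrE sV us Eu Ev wa wb pab _.
{ have inV y : y \in [:: u; v; w; a; x; b] -> y \in V by exact: sV.
  move: us; rewrite /= !inE !negb_or => /and5P[/and5P[uv uw ua ux ub]
    /and4P[vw va vx vb] /and3P[wa' wx wb'] /andP[ax ab] /andP[xb _]].
  apply: (@K33_of_seqs _ [:: u; w; x] [:: v; a; b]) => //=.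
  - by rewrite !inE negb_or uw ux wx.
  - by rewrite !inE negb_or va vb ab.
  - by move=> y; rewrite !inE => /or3P[]/eqP->; apply: inV; rewrite !inE eqxx ?orbT.
  - by move=> y; rewrite !inE => /or3P[]/eqP->; apply: inV; rewrite !inE eqxx ?orbT.
  move: pab => /= /and3P[Eax Exb _].
  rewrite /allrel /= wa wb Exb (symE x a) Eax (symE w v) (symE x v) !Eu ?Ev //.
  all: try by rewrite eq_sym.
  all: by apply: inV; rewrite !inE eqxx ?orbT. }
have xV : x \in V by apply: sV; rewrite !inE eqxx !orbT.
have x'V : x' \in V by apply: sV; rewrite !inE eqxx !orbT.
move: (pab) => /= /and3P[ax xx' px'].
(* Contracting x' into x shortens the inner path by one vertex; every edge avoiding x' survives, and
   x inherits the next edge of the path. *)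
apply: (has_K33_step (contract_edge xV x'V xx')).
have xneq y z : E y z -> y != z by apply: contraTneq => ->; rewrite irrE.
have memx' y : y \in [:: u, v, w, a, x & rcons s b] -> y != x'.
  have : uniq (x' :: [:: u, v, w, a, x & rcons s b]).
    rewrite (perm_uniq (s2 := u :: v :: w :: a :: rcons [:: x, x' & s] b)) //.
    exact: (permEl (perm_catCA [:: x'] [:: u; v; w; a; x] (rcons s b))).
  by case/andP=> nx' _ yI; apply: contraNneq nx' => <-.
set E' := fun _ _ => _.
have EE' y z : y != x' -> z != x' -> E y z -> E' y z.
  by rewrite /E' => -> -> yz; rewrite xneq // yz.
apply: (IHm (x :: s)) => //=.
- move=> y z; rewrite /E' (symE z y) (symE x' z) (symE y x') (eq_sym z y) andbCA.
  by rewrite (orbC ((y == x) && _)).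
- by move=> y; rewrite /E' eqxx !andbF.
- move=> y yI; rewrite !inE memx' //=; apply: sV; move: yI; rewrite !inE.
  by do 5 (case/orP; first by move=> ->; rewrite ?orbT); move=> ->; rewrite !orbT.
- move: us; rewrite (perm_uniq (s2 := x' :: [:: u, v, w, a, x & rcons s b])).
    by case/andP.
  rewrite perm_sym; exact: (permEl (perm_catCA [:: x'] [:: u; v; w; a; x] (rcons s b))).
- move=> y; rewrite !inE => /andP[yx' yV] yu; apply: EE' => //; last exact: Eu.
  by apply: memx'; rewrite !inE eqxx.
- move=> y; rewrite !inE => /andP[yx' yV] yv; apply: EE' => //; last exact: Ev.
  by apply: memx'; rewrite !inE eqxx ?orbT.
- by apply: EE' => //; apply: memx'; rewrite !inE eqxx ?orbT.
- by apply: EE' => //; apply: memx'; rewrite !inE ?mem_rcons ?inE eqxx ?orbT.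
apply/andP; split; first by apply: EE' => //; apply: memx'; rewrite !inE eqxx ?orbT.
have memr y : y \in rcons s b -> y != x'.
  by move=> yr; apply: memx'; rewrite !inE yr !orbT.
have xnr : x \notin rcons s b.
  by move: us; rewrite /= => /and5P[_ _ _ _ /andP[]]; rewrite inE negb_or => /andP[].
case: (rcons s b) px' memr xnr => //= h t /andP[x'h pht] memr xnr.
apply/andP; split.
  have hx' : h != x' by apply: memr; rewrite inE eqxx.
  have xx : x != x' by apply: memx'; rewrite !inE eqxx ?orbT.
  have xh : x != h by move: xnr; rewrite inE negb_or => /andP[].
  by rewrite /E' xx hx' xh eqxx x'h orbT.
apply: (sub_in_path (P := predC1 x')) pht.
  by move=> y z /= yx' zx'; apply: EE'.
by apply/allP => y yt; exact: memr.
Qed.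

(** Suppose a and b are not adjacent. A path from a to b in [U] without w has an inner vertex, which
    gives a K_{3,3} minor by [K33_of_path]. Without such a path, the component of a in [U] minus w
    violates parity. *)
Lemma two_regular_triangles (n : nat) (V U : {set 'I_n}) (E : rel 'I_n) u v w a b :
  symmetric E -> irreflexive E -> ~ has_K33 (V, E) ->
  u \in V -> v \in V -> u != v ->
  (forall x, x \in V -> x != u -> E u x) -> (forall x, x \in V -> x != v -> E v x) ->
  U \subset V :\ u :\ v ->
  (forall x y, x \in U -> y \in V :\ u :\ v -> E x y -> y \in U) ->
  (forall x, x \in U -> #|nbrs (V :\ u :\ v) E x| = 2) ->
  w \in U -> a != b -> nbrs (V :\ u :\ v) E w = [set a; b] -> E a b.
Proof.
move=> symE irrE noK uV vV uv Eu Ev UL Ucl U2 wU ab wab.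
set L := V :\ u :\ v in UL Ucl U2 wab.
have /andP[aL wa] : (a \in L) && E w a by have := set21 a b; rewrite -wab inE.
have /andP[bL wb] : (b \in L) && E w b by have := set22 a b; rewrite -wab inE.
have aU := Ucl _ _ wU aL wa; have bU := Ucl _ _ wU bL wb.
have neE x y : E x y -> x != y by apply: contraTneq => ->; rewrite irrE.
pose U' := U :\ w; pose e' := [rel x y | [&& x \in U', y \in U' & E x y]].
have aU' : a \in U' by rewrite !inE eq_sym neE.
have bU' : b \in U' by rewrite !inE eq_sym neE.
apply/negPn/negP=> nab.
have [/connectP[p]|nconn] := boolP (connect e' a b).
  case/shortenP=> p' pp' up' _ lp.
  case/lastP: p' pp' up' lp => [|s b' pp' up' lp]; first by move=> _ _ /= eab; rewrite eab eqxx in ab.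
  rewrite last_rcons in lp; subst b'.
  have allU' y : y \in a :: rcons s b -> y \in U'.
    rewrite inE => /orP[/eqP->//|]; move: (pp').
    elim: (rcons s b) (a) => //= z t IHt c /andP[/and3P[_ zU' _] pt].
    by rewrite inE => /orP[/eqP->//|]; apply: IHt pt.
  have L_of y : y \in U' -> [/\ y \in V, y != u, y != v & y != w].
    by rewrite !inE => /andP[yw /(subsetP UL)]; rewrite !inE => /and3P[-> -> ->].
  apply: noK; apply: (@K33_of_path _ V E u v w a b s) => //.
  - have wV : w \in V by move/(subsetP UL): wU; rewrite !inE => /and3P[].
    move=> y; rewrite inE => /orP[/eqP->//|]; rewrite inE => /orP[/eqP->//|].
    by rewrite inE => /orP[/eqP->//|/allU'/L_of[]].
  - have /and3P[wv wu _] : [&& w != v, w != u & w \in V].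
      by move/(subsetP UL): wU; rewrite !inE.
    rewrite 3!cons_uniq up' andbT !inE !negb_or uv (eq_sym u w) wu (eq_sym v w) wv /=.
    have notI z : (forall y, y \in U' -> y != z) -> (z != a) && (z \notin rcons s b).
      by move=> H; rewrite -negb_or -in_cons; apply/negP=> /allU'/H; rewrite eqxx.
    by rewrite !notI // => y /L_of[].
  - by apply: sub_path pp' => x y /and3P[].
  by apply: contraNneq nab => s0; move: pp'; rewrite s0 /= => /andP[/and3P[]].
(* In [K] the vertex a has lost its neighbour w and has degree 1, while all other vertices keep
   degree 2, since b is outside: the degree sum is odd. *)
pose K := [set x in U' | connect e' a x].
have aK : a \in K by rewrite inE aU' connect0.
have bnK : b \notin K by rewrite inE negb_and nconn orbT.
have nK x : x \in K -> nbrs K E x = nbrs L E x :\ w.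
  rewrite inE => /andP[xU' ax]; apply/setP=> y; rewrite !inE -/L.
  move: (xU'); rewrite inE => /andP[xw xU].
  apply/idP/idP => [/andP[/andP[/andP[yw yU] ay] Exy]|/andP[yw /andP[yL Exy]]].
    by rewrite yw Exy andbT; move/(subsetP UL): yU; rewrite !inE.
  have yU : y \in U by apply: Ucl xU _ Exy; rewrite !inE.
  rewrite yw yU Exy andbT /=; apply: connect_trans ax (connect1 _).
  by rewrite /= xU' !inE yw yU.
have := degsum_even K symE irrE.
rewrite /degsum (big_setD1 a aK) /= nK // oddD.
have -> : #|nbrs L E a :\ w| = 1%N.
  have := cardsD1 w (nbrs L E a); rewrite (U2 a aU) inE (subsetP UL w wU) symE wa.
  by case.
rewrite (eq_bigr (fun=> 2)) ?sum_nat_const ?muln2 ?odd_double // => x.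
rewrite in_setD1 => /andP[xa xK]; rewrite nK //.
have xU : x \in U by move: xK; rewrite !inE => /andP[/andP[]].
rewrite -(U2 x xU) [in RHS](cardsD1 w) inE (subsetP UL w wU) symE.
have : x \notin [set a; b].
  by rewrite !inE negb_or xa; apply: contraTneq xK => ->.
by rewrite -wab inE (subsetP UL x xU) /= => /negPf->.
Qed.

(** * Recognizing the extremal graph *)

(** Disjoint triangles plus possibly one smaller clique, encoded by positions in a list so as to
    match the blocks [(i - 2) %/ 3] of [F33]. *)
Definition triangle_listing (n : nat) (A : {set 'I_n}) (E : rel 'I_n) (l : seq 'I_n) : Prop :=
  [/\ uniq l, l =i A & forall x0 i j, (i < size l)%N -> (j < size l)%N ->
    E (nth x0 l i) (nth x0 l j) = (i != j) && (i %/ 3 == j %/ 3)%N].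

Lemma triangle_listing_small (n : nat) (A : {set 'I_n}) (E : rel 'I_n) (l : seq 'I_n) :
  irreflexive E -> uniq l -> l =i A -> (size l <= 3)%N ->
  {in l &, forall x y, x != y -> E x y} -> triangle_listing A E l.
Proof.
move=> irrE ul lA l3 El; split=> // x0 i j il jl.
rewrite !divn_small ?eqxx ?andbT; [|lia|lia].
have [->|ij] := eqVneq i j; first by rewrite irrE.
by rewrite El ?mem_nth // nth_uniq.
Qed.

Lemma triangle_listing_cons (n : nat) (A : {set 'I_n}) (E : rel 'I_n) (l : seq 'I_n) x y z :
  symmetric E -> irreflexive E -> triangle_listing A E l ->
  uniq [:: x; y; z] -> E x y -> E x z -> E y z ->
  (forall t w, t \in [:: x; y; z] -> w \in A -> w \notin [:: x; y; z] /\ ~~ E t w) ->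
  triangle_listing (x |: (y |: (z |: A))) E [:: x, y, z & l].
Proof.
move=> symE irrE [ul lA El] u3 xy xz yz sep; split.
- rewrite -[_ :: _]/([:: x; y; z] ++ l) cat_uniq u3 ul andbT.
  by apply/hasPn=> w /=; rewrite lA => /(sep x w (mem_head _ _))[].
- by move=> w; rewrite !inE lA.
have nE t w : t \in [:: x; y; z] -> w \in l -> E t w = false.
  by move=> tI; rewrite lA => wA; case: (sep t w tI wA) => _ /negPf.
have dS i : (i.+3 %/ 3 = (i %/ 3).+1)%N by rewrite -addn3 divnDr // divnn addn1.
move=> x0 [|[|[|i]]] [|[|[|j]]] //= il jl; rewrite ?irrE ?(symE y x) ?(symE z x) ?(symE z y)
  ?xy ?xz ?yz ?dS //=; last by rewrite El.
all: by rewrite 1?(symE (nth _ _ _)) nE ?mem_nth // ?inE ?eqxx ?orbT.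
Qed.

(** Triangles are split off from [U] one at a time and put at the front of the list, so that an
    incomplete block stays last. *)
Lemma triangle_listing_ext (n : nat) (L U : {set 'I_n}) (E : rel 'I_n) (l : seq 'I_n) :
  symmetric E -> irreflexive E -> U \subset L ->
  (forall w, w \in U -> exists a b,
     [/\ a != b, nbrs L E w = [set a; b], E a b, a \in U & b \in U]) ->
  triangle_listing (L :\: U) E l -> exists l', triangle_listing L E l'.
Proof.
move=> symE irrE; have [m] := ubnP #|U|.
elim: m U L => // m IHm U L; rewrite ltnS => Um UL HU tl.
have [U0|[w wU]] := set_0Vmem U; first by exists l; rewrite U0 setD0 in tl.
have [a [b [ab nw Eab aU bU]]] := HU w wU.
have [wL [aL bL]] : w \in L /\ a \in L /\ b \in L by rewrite !(subsetP UL).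
have nE x y : x \in U -> y \in L -> E x y = (y \in nbrs L E x) by rewrite !inE => _ ->.
have wa : E w a by rewrite nE // nw set21.
have wb : E w b by rewrite nE // nw set22.
have neE x y : E x y -> x != y by apply: contraTneq => ->; rewrite irrE.
have nbr2 x y z : x \in U -> y != z -> y \in L -> z \in L -> E x y -> E x z ->
    nbrs L E x = [set y; z].
  move=> xU yz yL zL xy xz; have [c [d [cd nx _ _ _]]] := HU x xU.
  apply/esym/eqP; rewrite eqEcard nx !cards2 cd yz andbT -nx subUset !sub1set.
  by rewrite -!nE ?xy ?xz.
have na : nbrs L E a = [set w; b] by apply: nbr2 => //; rewrite ?neE // symE.
have nb : nbrs L E b = [set w; a] by apply: nbr2 => //; rewrite ?neE // symE.
pose T := [set w; a; b].
have TU : T \subset U by apply/subsetP=> x; rewrite !inE -orbA => /or3P[]/eqP->.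
have sepT t x : t \in T -> x \in L -> E t x -> x \in T.
  rewrite !inE -orbA => /or3P[]/eqP-> xL.
  - by rewrite nE // nw !inE => /orP[]->; rewrite ?orbT.
  - by rewrite nE // na !inE => /orP[]->; rewrite ?orbT.
  - by rewrite nE // nb !inE => /orP[]->; rewrite ?orbT.
have [||x||l' tl'] := IHm (U :\: T) (L :\: T).
- apply: leq_trans Um; apply: proper_card; apply/properP; split; first exact: subsetDl.
  by exists w => //; rewrite !inE eqxx.
- exact: setSD.
- rewrite inE => /andP[xT xU]; have [c [d [cd nx Ecd cU dU]]] := HU x xU.
  have notT y : y \in nbrs L E x -> y \notin T.
    rewrite inE => /andP[yL xy]; apply: contra xT => yT; apply: sepT yT _ _.
      exact: (subsetP UL).
    by rewrite symE.
  exists c, d; split=> //; last 2 first.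
  - by rewrite inE cU notT // nx set21.
  - by rewrite inE dU notT // nx set22.
  rewrite -nx; apply/setP=> y; rewrite [LHS]inE in_setD -andbA.
  have -> : (y \in L) && E x y = (y \in nbrs L E x) by rewrite [RHS]inE.
  by case: (boolP (y \in nbrs L E x)) => [/notT->|]; rewrite ?andbF.
- move: tl; have -> // : L :\: T :\: (U :\: T) = L :\: U.
  apply/setP=> x; rewrite !in_setD; case: (boolP (x \in T)) => // xT.
    by rewrite (subsetP TU _ xT).

exists [:: w, a, b & l'].
have -> : L = w |: (a |: (b |: (L :\: T))).
  apply/setP=> x; rewrite !inE.
  case: eqP => [->//|_]; case: eqP => [->//|_]; by case: eqP => [->//|_].
apply: triangle_listing_cons => //.
  by rewrite /= !inE negb_or ab !neE.
move=> t x tT; rewrite !in_setD => /andP[xT xL].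
have sameT z : (z \in [:: w; a; b]) = (z \in T) by rewrite !inE orbA.
rewrite sameT xT; split=> //; apply: contra xT; apply: sepT => //.
by rewrite -sameT.
Qed.

(** The isomorphism sends each vertex to its index in the list [u :: v :: l]. *)
Lemma F33_iso (n : nat) (e : rel 'I_n) u v (l : seq 'I_n) :
  symmetric e -> irreflexive e -> u != v ->
  (forall x, x != u -> e u x) -> (forall x, x != v -> e v x) ->
  triangle_listing ([set~ u] :\ v) e l -> graph_iso e (F33 n).
Proof.
move=> symE irrE uv Eu Ev [ul lA El].
pose q := u :: v :: l.
have uq : uniq q by rewrite /= ul !inE !lA !inE !negb_or uv !eqxx ?andbF.
have qT x : x \in q by rewrite !inE lA !inE; case: eqP => //= _; case: eqP.
have sq : size q = n.
  by rewrite -(card_uniqP uq) -[RHS](card_ord n); apply: eq_card => x; rewrite qT.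
have il x : (index x q < n)%N by rewrite -[X in (_ < X)%N]sq index_mem.
pose g x := Ordinal (il x).
have ginj : injective g.
  by move=> x y [] /(congr1 (nth u q)); rewrite !nth_index.
exists (perm ginj) => x y; rewrite !permE /F33.
have -> : (g x != g y) = (x != y) by rewrite (inj_eq ginj).
have at_index z : exists2 i, (i < size q)%N & nat_of_ord (g z) = i /\ z = nth u q i.
  by exists (index z q); rewrite ?index_mem // nth_index.
have [i iq [-> ->]] := at_index x; have [j jq [-> ->]] := at_index y.
rewrite nth_uniq //; have nul z : z \in l -> (z != u) && (z != v).
  by rewrite lA !inE andbC.
have lP k : (k < size l)%N -> nth u l k \in l by apply: mem_nth.
move: i j iq jq => [|[|i]] [|[|j]] //= iq jq; rewrite ?irrE //; last by rewrite El ?subSS ?subn0.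
- by rewrite Eu // eq_sym.
- by rewrite Eu //; case/andP: (nul _ (lP j jq)).
- by rewrite Ev.
- by rewrite Ev //; case/andP: (nul _ (lP j jq)).
- by rewrite symE Eu //; case/andP: (nul _ (lP i iq)).
- by rewrite symE Ev //; case/andP: (nul _ (lP i iq)).
Qed.

(** * The signless Laplacian index *)

Definition signless_eigen (R : rcfType) (n : nat) (e : rel 'I_n) (l : R) (x : 'I_n -> R) :=
  forall j, l * x j = (deg e j)%:R * x j + \sum_(i | e j i) x i.

Lemma signlessQ_mul (R : rcfType) (n : nat) (e : rel 'I_n) (v : 'rV[R]_n) j :
  symmetric e ->
  (v *m signlessQ R e) 0 j = (deg e j)%:R * v 0 j + \sum_(i | e j i) v 0 i.
Proof.
move=> symE; rewrite mxE.
under eq_bigr => i _ do rewrite !mxE mulrDr.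
rewrite big_split /=; congr (_ + _).
  rewrite (bigD1 j) //= eqxx mulrC [X in _ + X]big1 ?addr0 // => i /negPf->.
  by rewrite mulr0.
rewrite [RHS]big_mkcond; apply: eq_bigr => i _.
by rewrite symE; case: (e j i); rewrite ?mulr1 ?mulr0.
Qed.

Lemma signless_rootP (R : rcfType) (n : nat) (e : rel 'I_n) (l : R) : symmetric e ->
  root (char_poly (signlessQ R e)) l <->
  exists2 x : 'I_n -> R, signless_eigen e l x & exists i, x i != 0.
Proof.
move=> symE; rewrite -eigenvalue_root_char; split=> [/eigenvalueP[v vQ v0]|[x xl [i xi]]].
  exists (v 0) => [j|]; first by rewrite -signlessQ_mul // vQ mxE.
  apply/existsP; rewrite -negb_forall; apply: contra v0 => /forallP v0.
  apply/eqP/matrixP=> a j; rewrite (ord1 a) mxE; have := v0 j.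
  by move=> /eqP.
apply/eigenvalueP; exists (\row_j x j).
  apply/rowP => j; rewrite signlessQ_mul // !mxE xl; congr (_ + _).
  by apply: eq_bigr => k _; rewrite mxE.
by apply: contraNneq xi => /rowP/(_ i); rewrite !mxE => ->.
Qed.

Lemma mem_rootsR (R : rcfType) (p : {poly R}) x : p != 0 -> (x \in rootsR p) = root p x.
Proof. by move=> p0; rewrite -(roots_on_rootsR p0) in_itv. Qed.

Lemma char_poly_neq0 (R : rcfType) (n : nat) (A : 'M[R]_n) : char_poly A != 0.
Proof. exact/monic_neq0/char_poly_monic. Qed.

Lemma root_le_q_index (R : rcfType) (n : nat) (e : rel 'I_n) (l : R) :
  root (char_poly (signlessQ R e)) l -> l <= q_index R e.
Proof.
move=> rl; apply: (@le_bigmax_seq _ _ _ _ _ l predT id) => //.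
by rewrite mem_rootsR ?char_poly_neq0.
Qed.

(** Positivity excludes the initial value 0 of the maximum, which need not be a root. *)
Lemma q_index_root (R : rcfType) (n : nat) (e : rel 'I_n) :
  0 < q_index R e -> root (char_poly (signlessQ R e)) (q_index R e).
Proof.
rewrite -mem_rootsR ?char_poly_neq0 // /q_index /lambda_max.
elim: (rootsR _) => [|x s IHs]; first by rewrite big_nil ltxx.
rewrite big_cons inE /Num.max; case: ifP => _ m0; last by rewrite eqxx.
by rewrite (IHs m0) orbT.
Qed.

(** A Perron argument: for another eigenpair (m, x), evaluate the equation at a vertex maximizing |x
    i| / y i and apply the triangle inequality; this gives m <= l. *)
Lemma q_index_pos_eigen (R : rcfType) (n : nat) (e : rel 'I_n) (l : R) (y : 'I_n -> R) :
  symmetric e -> (0 < n)%N -> (forall i, 0 < y i) -> signless_eigen e l y ->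
  q_index R e = l.
Proof.
move=> symE n0 y0 yl; pose i0 := Ordinal n0.
apply/eqP; rewrite eq_le; apply/andP; split; last first.
  apply/root_le_q_index/signless_rootP => //; exists y => //.
  by exists i0; rewrite gt_eqF.
have l0 : 0 <= l.
  rewrite -(pmulr_lge0 _ (y0 i0)) yl addr_ge0 ?sumr_ge0 // => [|i _]; last exact: ltW.
  by rewrite mulr_ge0 ?ler0n ?ltW.
rewrite /q_index /lambda_max big_seq; apply: bigmax_le => // m; rewrite mem_rootsR ?char_poly_neq0 //.
case/(signless_rootP _ symE)=> x xm [k xk].
pose F i := `|x i| / y i; have [j _ jmax] := @arg_maxP _ _ _ i0 predT F isT.
have xle i : `|x i| <= F j * y i by rewrite -ler_pdivrMr //; apply: jmax.
have Fj : 0 < F j.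
  have := xle k; rewrite -(pmulr_lgt0 _ (y0 k)); apply: lt_le_trans.
  by rewrite normr_gt0.
have xj : `|x j| = F j * y j by rewrite /F divfK // gt_eqF.
have : m * `|x j| <= l * `|x j|.
  apply: le_trans (ler_norm _) _; rewrite normrM normr_id -normrM xm.
  apply: le_trans (ler_normD _ _) _; rewrite normrM normr_nat xj mulrCA [l * _]mulrCA yl.
  rewrite mulrDr lerD2l mulr_sumr; apply: le_trans (ler_norm_sum _ _ _) _.
  exact: ler_sum.
by rewrite ler_pM2r // xj mulr_gt0.
Qed.

Lemma deg_natr (R : rcfType) (n : nat) (e : rel 'I_n) j :
  (deg e j)%:R = \sum_(i | e j i) 1 :> R.
Proof. by rewrite /deg -sumr_const; apply: eq_bigl => i; rewrite inE. Qed.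

Lemma signless_eigen_iso (R : rcfType) (n : nat) (e e' : rel 'I_n) (l : R) y (s : 'S_n) :
  (forall i j, e i j = e' (s i) (s j)) ->
  signless_eigen e' l y -> signless_eigen e l (y \o s).
Proof.
move=> es ye j; rewrite /= ye !deg_natr.
by congr (_ * _ + _); rewrite (reindex_perm s) /=; apply: eq_bigl => i; rewrite es.
Qed.

(** Both sides count the numbers below [N] in the block of three containing [J]; the summand
    [(J < N)] stands for [J] itself. *)
Lemma block_count (N J : nat) :
  (\sum_(i < N) ((J != i) && (J %/ 3 == i %/ 3)) + (J < N) =
   minn N (3 * (J %/ 3) + 3) - minn N (3 * (J %/ 3)))%N.
Proof.
elim: N => [|N IHN]; first by rewrite big_ord0; lia.
rewrite big_ord_recr /=; move: IHN; set S := (\sum_(_ < N) _)%N.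
have [<-|JN] := eqVneq J N => /=; first lia.
have [eJ|nJ] := eqVneq (J %/ 3)%N (N %/ 3)%N => /=; lia.
Qed.

Definition F33_vec (R : rcfType) (p : nat) (b c : R) (i : nat) : R :=
  if (i < 2)%N then 1 else if ((i - 2) %/ 3 < p)%N then b else c.

Lemma sum_F33_vec (R : rcfType) (p r : nat) (b c : R) : (r < 3)%N ->
  \sum_(i < 3 * p + r) F33_vec p b c i.+2 = b *+ (3 * p) + c *+ r.
Proof.
move=> r3; rewrite -(big_mkord xpredT (fun i => F33_vec p b c i.+2)).
rewrite (@big_cat_nat _ _ _ (3 * p)%N) //=; last exact: leq_addr.
congr (_ + _).
  rewrite (eq_big_nat _ _ (F2 := fun=> b)) => [|i /andP[_ ip]].
    by rewrite sumr_const_nat subn0.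
  by rewrite /F33_vec subSS subn1 /= ifT //; lia.
rewrite (eq_big_nat _ _ (F2 := fun=> c)) => [|i /andP[pi ir]].
  by rewrite sumr_const_nat; congr (_ *+ _); lia.
by rewrite /F33_vec subSS subn1 /= ifF //; lia.
Qed.

(** The hypotheses are the eigenvector equations by type of vertex: l b = 4 b + 2 b + 2 in a
    triangle, l c = (r + 1) c + (r - 1) c + 2 in the last block, and l = (n - 1) + 1 + 3 p b + r c
    at a dominating vertex. *)
Lemma F33_eigen (R : rcfType) (p r : nat) (l b c : R) : (r < 3)%N ->
  (l - 6) * b = 2 -> (l - 2 * r%:R) * c = 2 ->
  l - (3 * p + r + 2)%:R = b *+ (3 * p) + c *+ r ->
  signless_eigen (F33 (3 * p + r).+2) l (fun i => F33_vec p b c i).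
Proof.
move=> r3 lb lc ln j; rewrite deg_natr mulr_suml -big_split /=.
under eq_bigr => i _ do rewrite mul1r.
rewrite natrD in ln; set N := (3 * p + r)%N in ln *; set g := F33_vec p b c.
have SN : \sum_(i < N) g i.+2 = b *+ (3 * p) + c *+ r by exact: sum_F33_vec.
rewrite big_mkcond /= !big_ord_recl /F33 /=.
have dom : l = 2 + (\sum_(i < N) (1 + g i.+2)).
  rewrite big_split /= SN -ln sumr_const card_ord; ring.
case: j => -[|[|J]] /= Jn.
- rewrite /g /F33_vec /= mulr1 add0r {1}dom; congr (_ + _).
- rewrite /g /F33_vec /= mulr1 add0r {1}dom; congr (_ + _).
have -> : \sum_(i < N) (if (Ordinal Jn != lift ord0 (lift ord0 i)) && ((J.+2 - 2) %/ 3 == (bump 0 (bump 0 i) - 2) %/ 3)%N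
    then g J.+2 + g (bump 0 (bump 0 i)) else 0) =
  (g J.+2 *+ 2) *+ (\sum_(i < N) ((J != i) && (J %/ 3 == i %/ 3))%N).
  rewrite -sumrMnr; apply: eq_bigr => i _; rewrite -val_eqE /= /bump /= !subSS !subn0 !eqSS.
  case: eqP => //= _; case: eqP => //= eJ.
  by rewrite mulr1n mulr2n /g /F33_vec /= !subSS !subn0 -eJ.
have JN : (J < N)%N by [].
have := block_count N J; rewrite JN; set S := (\sum_(i < N) _)%N => cnt.
rewrite /g /F33_vec /= !subSS !subn0; case: ifP => Jp.
  have -> : S = 2%N by move: S cnt JN; rewrite /N; lia.
  have -> : l * b = (l - 6) * b + 6 * b by ring.
  rewrite lb.
  ring.
have -> : S = r.-1 by move: S cnt JN; rewrite /N; lia.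
have -> : l * c = (l - 2 * r%:R) * c + 2 * r%:R * c by ring.
rewrite lc.
have -> : r = r.-1.+1 by move: JN; rewrite /N; lia.
by rewrite /= -addn1 natrD; ring.
Qed.

(** * The cubic *)

Lemma order_natr (R : rcfType) (p r : nat) :
  (3 * p + r).+2%:R = (3 * p)%:R + r%:R + 2 :> R.
Proof. by rewrite -addn2 !natrD. Qed.

(** The cubic is x - n = 6 p / (x - 6) + 2 r / (x - 2 r), the equation at a dominating vertex, with
    denominators cleared. *)
Lemma cubicF_factored (R : rcfType) (p r : nat) (x : R) :
  cubicF (3 * p + r).+2 r x =
  (x - (3 * p + r).+2%:R) * (x - 6) * (x - 2 * r%:R) - 2 * (3 * p)%:R * (x - 2 * r%:R)
  - 2 * r%:R * (x - 6).
Proof. by rewrite /cubicF order_natr; ring. Qed.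

(** Above n + 2 both denominators are positive, hence so is the eigenvector. As any root in this
    range is allowed, the lemma also shows that there is at most one. *)
Lemma q_index_F33 (R : rcfType) (p r : nat) (e : rel 'I_(3 * p + r).+2) (l : R) :
  (r < 3)%N -> (2 < p)%N -> (3 * p + r).+2%:R + 2 < l -> cubicF (3 * p + r).+2 r l = 0 ->
  symmetric e -> graph_iso e (F33 (3 * p + r).+2) -> q_index R e = l.
Proof.
move=> r3 p2 nl; rewrite cubicF_factored => c0 symE [s es].
have r2 : (r%:R : R) <= 2 by rewrite (ler_nat R r 2) -ltnS.
have r0 : 0 <= (r%:R : R) by rewrite ler0n.
have n9 : (11%:R : R) <= (3 * p + r).+2%:R by rewrite ler_nat; lia.
have l6 : 0 < l - 6 by lra.
have lr : 0 < l - 2 * r%:R by lra.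
have e6 : (l - 6) * (2 / (l - 6)) = 2 by rewrite mulrC divfK // gt_eqF.
have er : (l - 2 * r%:R) * (2 / (l - 2 * r%:R)) = 2 by rewrite mulrC divfK // gt_eqF.
have yl : signless_eigen (F33 (3 * p + r).+2) l
    (fun i => F33_vec p (2 / (l - 6)) (2 / (l - 2 * r%:R)) i).
  apply: F33_eigen => //; move: e6 er; move: (2 / (l - 6)) (2 / (l - 2 * r%:R)) => b c e6 er.
  have ab : (l - 6) * (l - 2 * r%:R) != 0 by rewrite mulf_neq0 // gt_eqF.
  apply: (mulfI ab); rewrite -[b *+ _]mulr_natr -[c *+ _]mulr_natr addn2.
  have -> : (l - 6) * (l - 2 * r%:R) * (b * (3 * p)%:R + c * r%:R) =
    (l - 6) * b * (l - 2 * r%:R) * (3 * p)%:R + (l - 2 * r%:R) * c * (l - 6) * r%:R by ring.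
  rewrite e6 er; apply/eqP; rewrite -subr_eq0 -[X in _ == X]c0; apply/eqP; ring.
apply: (q_index_pos_eigen symE _ _ (signless_eigen_iso es yl)) => // i.
by rewrite /= /F33_vec; case: ifP => // _; case: ifP => _; rewrite divr_gt0.
Qed.

(** Divided by (x - 6)(x - 2 r), the cubic becomes x - n - 6 p / (x - 6) - 2 r / (x - 2 r), which is
    increasing for x > 6; [key] is this comparison without fractions. *)
Lemma cubicF_ge0 (R : rcfType) (p r : nat) (l m : R) :
  (r < 3)%N -> 6 < l -> l <= m -> cubicF (3 * p + r).+2 r l = 0 ->
  0 <= cubicF (3 * p + r).+2 r m.
Proof.
move=> r3 l6 lm; rewrite !cubicF_factored; set n := _.+2%:R.
have r2 : (r%:R : R) <= 2 by rewrite (ler_nat R r 2) -ltnS.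
have r0 : 0 <= (r%:R : R) by rewrite ler0n.
have p0 : 0 <= ((3 * p)%:R : R) by rewrite ler0n.
move: r%:R (3 * p)%:R n r2 r0 p0 => q t n q2 q0 t0 c0.
have [a0 b0 a1 b1] : [/\ 0 < l - 6, 0 < l - 2 * q, 0 < m - 6 & 0 < m - 2 * q].
  by split; lra.
have ab : 0 < (l - 6) * (l - 2 * q) by rewrite mulr_gt0.
have key : (l - 6) * (l - 2 * q) *
   ((m - n) * (m - 6) * (m - 2 * q) - 2 * t * (m - 2 * q) - 2 * q * (m - 6)) =
   (m - 6) * (m - 2 * q) *
   ((l - n) * (l - 6) * (l - 2 * q) - 2 * t * (l - 2 * q) - 2 * q * (l - 6)) +
   (m - l) * ((l - 6) * (l - 2 * q) * (m - 6) * (m - 2 * q)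
      + 2 * t * ((l - 2 * q) * (m - 2 * q)) + 2 * q * ((l - 6) * (m - 6))) by ring.
rewrite -(pmulr_rge0 _ ab) key c0 mulr0 add0r.
by rewrite mulr_ge0 ?subr_ge0 // !addr_ge0 // !mulr_ge0 // ltW.
Qed.

(** One inequality that serves all three values of r. For r = 2 it is the hypothesis itself, with 8
    = 4 (m - 4) - 4 (m - 6); for r = 0 and r = 1 it is a weakening. *)
Lemma cubicF_ge0_excess (R : rcfType) (p r : nat) (m : R) :
  (r < 3)%N -> 6 < m -> 0 <= cubicF (3 * p + r).+2 r m ->
  2 * (3 * p + r)%:R * (m - 4) <= (m - (3 * p + r).+2%:R) * (m - 6) * (m - 4) + 8.
Proof.
move=> r3 m6; rewrite cubicF_factored !order_natr natrD; move: (3 * p)%:R => t.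
case: r r3 => [|[|[|//]]] _ c0.
- pose B := (m - (t + 2)) * (m - 6) - 2 * t.
  have : 0 <= m * B by move: c0; congr (0 <= _); rewrite /B; ring.
  rewrite pmulr_rge0 => [B0|]; last lra.
  have : 0 <= (m - 4) * B by rewrite mulr_ge0 //; lra.
  rewrite /B; lra.
- pose B := (m - (t + 3)) * (m - 6) - 2 * (t + 1).
  have : 0 <= (m - 2) * B + 8 by move: c0; congr (0 <= _); rewrite /B; ring.
  suff : 0 <= (m - 2) * B + 8 -> 0 <= (m - 4) * B + 8.
    by move=> H /H; rewrite /B; lra.
  case: (leP 0 B) => B0 H; last by lra.
  by rewrite addr_ge0 ?mulr_ge0 //; lra.
by move: c0; rewrite -subr_ge0 -[X in _ -> is_true (X)]subr_ge0; lra.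
Qed.

(** The cubic is negative at n + 2 and nonnegative at n + 6. *)
Lemma cubicF_root (R : rcfType) (p r : nat) :
  (r < 3)%N -> (2 < p)%N ->
  exists2 l : R, (3 * p + r).+2%:R + 2 < l & cubicF (3 * p + r).+2 r l = 0.
Proof.
move=> r3 p2; have rR : [\/ (r%:R : R) = 0, (r%:R : R) = 1 | (r%:R : R) = 2].
  by case: r r3 => [|[|[|//]]] _; [constructor 1 | constructor 2 | constructor 3].
set n := (3 * p + r).+2.
pose P : {poly R} := 'X^3 - (n%:R + 2 * r%:R + 6) *: 'X^2
  + (12 * r%:R + 4 * n%:R + 2 * r%:R * n%:R + 4) *: 'X
  + (4 * r%:R - 8 * r%:R * n%:R - 4 * r%:R ^+ 2)%:P.
have PE x : P.[x] = cubicF n r x.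
  have PE a b c : ('X^3 - a *: 'X^2 + b *: 'X + c%:P).[x] = x ^+ 3 - a * x ^+ 2 + b * x + c.
    by rewrite !hornerE.
  by rewrite /P PE /cubicF; ring.
have p3 : (3 : R) <= p%:R by rewrite (ler_nat R 3 p).
have lo : P.[n%:R + 2] < 0.
  rewrite PE cubicF_factored /n order_natr natrM.
  by case: rR => ->; nra.
have hi : 0 <= P.[n%:R + 6].
  rewrite PE cubicF_factored /n order_natr natrM.
  by case: rR => ->; nra.
have [||x /andP[ax _] rx] := @poly_ivt R P (n%:R + 2) (n%:R + 6).
- by lra.
- by rewrite (ltW lo) hi.
exists x; last by rewrite -PE; apply/eqP.
rewrite lt_neqAle ax andbT; apply: contraTneq lo => ->.
by rewrite (eqP rx) ltxx.
Qed.

(** * Two dominating vertices *)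

(* [W] is the sum of deg z * y z and [S] the sum of y z over the vertices z
   other than u and v.  The bound on W is used twice: first with the crude
   Y <= 16, then with the bound on Y that results from it. *)
Lemma weights_force_domination (R : realFieldType) (n l du dv yu S W Y : R) :
  1186 <= n -> n + 2 < l -> du <= n - 1 -> dv <= n - 1 -> 0 <= yu <= 1 -> 0 <= S ->
  Y <= 16 -> Y = 1 + yu + S -> (n - 10) * W <= 16 * n * Y ->
  l * S <= dv + du * yu + 2 * W -> l <= dv + yu + S -> l * yu <= du * yu + 1 + S ->
  n - 2 < du /\ n - 2 < dv.
Proof.
move=> n1 nl dun dvn /andP[yu0 yu1] S0 Y16 YE WY lS lv lu.
(* 16 n / (n - 10) <= 81 / 5 holds from n = 810 on. *)
have W_le c : 0 <= c -> Y <= c -> W <= 81 / 5 * c.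
  move=> c0 Yc; have : (n - 10) * W <= (n - 10) * (81 / 5 * c).
    apply: le_trans WY _; apply: (@le_trans _ _ (16 * n * c)).
      by rewrite ler_wpM2l //; lra.
    have : 0 <= c * (n - 810) by rewrite mulr_ge0 //; lra.
    lra.
  by rewrite ler_pM2l //; lra.
have S_le c : 0 <= c -> Y <= c -> l * (S - 1 - yu) <= 162 / 5 * c.
  move=> c0 Yc; have := W_le c c0 Yc.
  have : 0 <= (l - du) * yu by rewrite mulr_ge0 //; lra.
  lra.
have S_lt c t : 0 <= c -> Y <= c -> 0 <= t -> 162 / 5 * c < 1188 * t -> S <= 1 + yu + t.
  move=> c0 Yc t0 ct; rewrite leNgt; apply/negP=> big.
  have := S_le c c0 Yc; have : 0 <= (l - 1188) * t by rewrite mulr_ge0 //; lra.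
  have : 0 <= l * (S - 1 - yu - t) by rewrite mulr_ge0 //; lra.
  lra.
(* With yu <= 1 this improves the bound on Y = 1 + yu + S from 16 to 4 + 11 / 25 = 111 / 25, which
   is fed back in the next line. *)
have S1 : S <= 1 + yu + 11 / 25 by apply: (S_lt 16); lra.
have S2 : S <= 1 + yu + 1 / 8 by apply: (S_lt (111 / 25)); lra.
(* If du <= n - 2 then l - du > 4, and the inequality at u gives 3 yu <= 17 / 8, whereas the one at
   v needs 2 yu > 15 / 8. *)
split; rewrite ltNge; apply/negP=> small; last by lra.
have : 0 <= (l - du - 4) * yu by rewrite mulr_ge0 //; lra.
lra.
Qed.

Lemma sum_nbrs_exchange (R : rcfType) (n : nat) (e : rel 'I_n) (y : 'I_n -> R) :
  symmetric e -> \sum_w \sum_(t | e w t) y t = \sum_t (deg e t)%:R * y t.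
Proof.
move=> symE; rewrite (exchange_big_dep xpredT) //=; apply: eq_bigr => t _.
rewrite deg_natr mulr_suml; apply: eq_big => [w|w _]; first by rewrite symE.
by rewrite mul1r.
Qed.

Lemma deg_lt (n : nat) (e : rel 'I_n) i : irreflexive e -> (deg e i < n)%N.
Proof.
move=> irrE; rewrite -[X in (_ < X)%N]card_ord; apply: (@leq_ltn_trans #|[set~ i]|).
  apply/subset_leq_card/subsetP=> j; rewrite !inE; apply: contraTneq => ->.
  by rewrite irrE.
by rewrite cardsC1; case: n i {irrE e} => [[]|n _] //; rewrite card_ord.
Qed.

Lemma deg_full (n : nat) (e : rel 'I_n) i x :
  irreflexive e -> (n <= (deg e i).+1)%N -> x != i -> e i x.
Proof.
move=> irrE di xi; apply: contraLR di => nix; rewrite -ltnNge.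
have : (#|[set j | e i j]| <= #|[set~ i] :\ x|)%N.
  apply/subset_leq_card/subsetP=> j; rewrite !inE => ij; apply/andP; split.
    by apply: contraTneq ij => ->.
  by apply: contraTneq ij => ->; rewrite irrE.
have := cardsD1 x [set~ i]; rewrite !inE xi cardsC1 card_ord /deg /=.
have := ltn_ord i; move: #|_| #|_ :\ _|; lia.
Qed.

(** At most k vertices are not adjacent to v, and at most 2 are adjacent to all of u, v, z, so u and
    z have at most k + 2 common neighbours. *)
Lemma common_nbrs_deg (n : nat) (e : rel 'I_n) u v z k :
  symmetric e -> irreflexive e -> ~ has_K33 (setT, e) -> uniq [:: u; v; z] ->
  (n <= deg e v + k)%N -> (deg e u + deg e z <= n + k + 2)%N.
Proof.
move=> symE irrE noK uq dv; rewrite /deg -cardsUI.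
set A := [set j | e u j]; set B := [set j | e z j]; pose C := [set j | e v j].
have AB : (#|A :|: B| <= n)%N by rewrite -[X in (_ <= X)%N]card_ord max_card.
have := cardsID C (A :&: B); set ABC := A :&: B :&: C.
have : (#|(A :&: B) :\: C| <= #|~: C|)%N.
  by apply/subset_leq_card/subsetP=> x; rewrite !inE => /andP[].
have := cardsC C; rewrite card_ord.
have : (#|ABC| <= 2)%N.
  rewrite leqNgt; apply/negP=> big; apply: noK.
  apply: (@K33_common_nbrs _ setT e u v z); rewrite ?in_setT //; apply: leq_trans big _.
  apply/subset_leq_card/subsetP=> x; rewrite !inE.
  by case/andP=> /andP[-> ->] ->.
move: dv; rewrite /deg -/C; move: AB.
move: #|A :|: B| #|A :&: B| #|ABC| #|A :&: B :\: C| #|C| #|~: C|; lia.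
Qed.

(** Here y is meant to be |x| scaled to maximum 1, for which only an inequality survives. The vertex
    u is one of largest degree other than v. *)
Lemma two_dominating (R : rcfType) (n : nat) (e : rel 'I_n) (l : R) (y : 'I_n -> R) v :
  (1186 <= n)%N -> symmetric e -> irreflexive e -> ~ has_K33 (setT, e) ->
  n%:R + 2 < l -> (forall i, 0 <= y i <= 1) -> y v = 1 ->
  (forall w, l * y w <= (deg e w)%:R * y w + \sum_(t | e w t) y t) ->
  exists u, [/\ u != v, forall x, x != u -> e u x & forall x, x != v -> e v x].
Proof.
move=> n1 symE irrE noK nl y01 yv sub.
have nR : (1186%:R : R) <= n%:R by rewrite ler_nat.
have y0 i : 0 <= y i by case/andP: (y01 i).
have y1 i : y i <= 1 by case/andP: (y01 i).
have sum_le (P : pred 'I_n) (F : 'I_n -> R) : (forall i, 0 <= F i) ->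
    \sum_(i | P i) F i <= \sum_i F i.
  by move=> F0; rewrite [X in _ <= X](bigID P) /= lerDl sumr_ge0.
pose D : R := \sum_i (deg e i)%:R.
have D8 : D <= 8 * n%:R.
  have n0 : (0 < #|[set: 'I_n]|)%N by rewrite cardsT card_ord; lia.
  have := degsum_bound symE irrE n0 noK; rewrite cardsT card_ord => db.
  rewrite /D -natr_sum -(natrM R 8 n) ler_nat.
  apply: leq_trans db; apply: leq_trans (leq_addr _ _).
  rewrite /degsum [X in (_ <= X)%N](eq_bigl xpredT) => [|i]; last by rewrite inE.
  by apply: leq_sum => i _; apply/subset_leq_card/subsetP=> j; rewrite !inE.
have dy0 i : 0 <= (deg e i)%:R * y i by rewrite mulr_ge0.
have dy_le : \sum_i (deg e i)%:R * y i <= D.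
  by apply: ler_sum => i _; rewrite ler_piMr.
pose Y := \sum_i y i.
(* Summed over all vertices, the inequalities give l Y <= 2 D <= 16 n, and l > n. *)
have Y16 : Y <= 16.
  have : l * Y <= 16 * n%:R.
    rewrite /Y mulr_sumr; apply: le_trans (ler_sum _ (fun w _ => sub w)) _.
    by rewrite big_split /= sum_nbrs_exchange //; lra.
  move=> H; rewrite leNgt; apply/negP=> big.
  have : 0 <= l * (Y - 16) by rewrite mulr_ge0 //; lra.
  lra.
have nbr_le w : \sum_(t | e w t) y t <= Y - y w.
  rewrite /Y [X in _ <= X - _](bigD1 w) //= addrC addrK.
  rewrite [X in _ <= X](bigID (e w)) /= [X in _ <= X + _](eq_bigl (e w)) ?lerDl ?sumr_ge0 //.
  by move=> t; apply: andb_idl; apply: contraTneq => ->; rewrite irrE.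
have dvl : l <= (deg e v)%:R + (Y - 1).
  by have := sub v; have := nbr_le v; rewrite yv !mulr1; lra.
(* d(v) >= l - 15 > n - 13. *)
have dv12 : (n <= deg e v + 12)%N.
  by rewrite -ltnS -addnS -(ltr_nat R) natrD; lra.
have dn i : ((deg e i)%:R : R) <= n%:R - 1.
  by rewrite lerBrDr natr1 ler_nat deg_lt.
have [i0 i0v] : exists i0, i0 != v.
  have /card_gt0P[i0] : (0 < #|[set~ v]|)%N by rewrite cardsC1 card_ord; lia.
  by rewrite !inE; exists i0.
have [u uv umax] := @arg_maxnP _ i0 (fun i => i != v) (deg e) i0v.
exists u; pose P := [pred z | (z != v) && (z != u)].
have sumP (F : 'I_n -> R) : \sum_i F i = F v + F u + \sum_(i | P i) F i.
  rewrite (bigD1 v) //= (bigD1 u) //= addrA; congr (_ + _).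
pose S := \sum_(i | P i) y i; pose W := \sum_(i | P i) (deg e i)%:R * y i.
(* As d(z) <= d(u), twice d(z) is at most n + 14, so 2 (l - d(z)) > 2 (n + 2) - (n + 14) = n -
   10. *)
have yz z : P z -> (n%:R - 10) * y z <= 2 * Y.
  case/andP=> zv zu; have := umax z zv => dzu.
  have : (deg e u + deg e z <= n + 12 + 2)%N.
    by apply: (@common_nbrs_deg _ e u v z) => //=; rewrite !inE negb_or uv eq_sym zu eq_sym zv.
  move=> duz; have : (deg e z + deg e z <= n + 14)%N by lia.
  rewrite -(ler_nat R) !natrD => dz.
  have := sub z; have := nbr_le z; have := y0 z => yz0.
  have : 0 <= (2 * (l - (deg e z)%:R) - (n%:R - 10)) * y z by rewrite mulr_ge0 //; lra.
  lra.
have [du dv] : n%:R - 2 < (deg e u)%:R :> R /\ n%:R - 2 < (deg e v)%:R :> R.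
  apply: (@weights_force_domination R n%:R l _ _ (y u) S W Y) => //.
  - by rewrite sumr_ge0.
  - by rewrite /Y sumP yv.
  - rewrite /W mulr_sumr; apply: (@le_trans _ _ (\sum_(i | P i) (deg e i)%:R * (2 * Y))).
      by apply: ler_sum => i Pi; rewrite mulrCA ler_wpM2l // yz.
    rewrite -mulr_suml; apply: (@le_trans _ _ (D * (2 * Y))).
      by rewrite ler_wpM2r ?sum_le // mulr_ge0 ?sumr_ge0.
    apply: (@le_trans _ _ (8 * n%:R * (2 * Y))); last by lra.
    by rewrite ler_wpM2r // mulr_ge0 ?sumr_ge0.
  - rewrite /S mulr_sumr; apply: le_trans (ler_sum _ (fun w _ => sub w)) _.
    rewrite big_split /= -/W.
    have : \sum_(i | P i) \sum_(t | e i t) y t <= \sum_i \sum_(t | e i t) y t.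
      by apply: sum_le => i; rewrite sumr_ge0.
    by rewrite sum_nbrs_exchange // sumP yv mulr1 -/W; lra.
  - by move: dvl; rewrite /Y sumP yv -/S; lra.
  - by have := sub u; have := nbr_le u; rewrite /Y sumP yv -/S; lra.
have full i : n%:R - 2 < (deg e i)%:R :> R -> (n <= (deg e i).+1)%N.
  by move=> H; rewrite -ltnS -(ltr_nat R) -addn2 natrD; lra.
by split=> // x; apply: deg_full => //; apply: full.
Qed.

(** * The remaining vertices *)

(* Up to the factor T - 2, a vertex of degree 0 contributes 2 (T - 2) / T > 1 to
   the deficiency, and a vertex of degree 1 contributes at least 1, with equality
   only if its neighbour also has degree 1.  A single vertex of degree 1 is
   excluded by the parity of the degree sum. *)
Lemma two_factor_remainder (R : rcfType) (n : nat) (L : {set 'I_n}) (e : rel 'I_n)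
    (T : R) (z : 'I_n -> R) (U := [set w in L | #|nbrs L e w| == 2]) :
  symmetric e -> irreflexive e -> 4 < T ->
  (forall w, w \in L -> #|nbrs L e w| <= 2)%N ->
  (forall w, w \in L -> 0 < z w) ->
  (forall w, w \in L -> (T - #|nbrs L e w|%:R) * z w = 1 + \sum_(t in nbrs L e w) z t) ->
  (T - 2) * (\sum_(w in L) (2 - #|nbrs L e w|%:R) * z w) <= 2 ->
  exists l, [/\ uniq l, l =i L :\: U, (size l <= 2)%N,
    {in l &, forall x y, x != y -> e x y} & forall x y, x \in L :\: U -> y \in U -> ~~ e x y].
Proof.
move=> symE irrE T4 d2 z0 ze Zle; set C := L :\: U.
pose d w := #|nbrs L e w|; pose f w : R := (T - 2) * ((2 - (d w)%:R) * z w).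
have CL w : w \in C -> w \in L by rewrite inE => /andP[].
have dC w : w \in C -> (d w < 2)%N.
  rewrite !inE => /andP[nU wL]; rewrite wL /= in nU.
  by rewrite ltn_neqAle nU d2.
have f_isolated w : w \in L -> d w = 0 -> 1 < f w.
  move=> wL dw; have := ze w wL; rewrite /f -/(d w) dw subr0.
  have -> : nbrs L e w = set0 by apply/cards0_eq.
  rewrite big_set0 addr0 subr0 => Tz; have := z0 w wL.
  nra.
have f_end w t : w \in L -> nbrs L e w = [set t] ->
    1 <= f w /\ (f w <= 1 -> nbrs L e t = [set w]).
  move=> wL nw; have dw : d w = 1 by rewrite /d nw cards1.
  have := ze w wL; rewrite /f -/(d w) dw nw big_set1 => zw.
  have /andP[tL wt] : (t \in L) && e w t by have := set11 t; rewrite -nw inE.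
  have wt' : w \in nbrs L e t by rewrite inE wL symE.
  have dt0 : (0 < d t)%N by apply/card_gt0P; exists w.
  have := z0 w wL; have := z0 t tL; have := ze t tL; rewrite -/(d t).
  have [dt1 zt _ _|dt2 zt pt pw] := leqP (d t) 1.
    have dt : d t = 1%N by lia.
    have nt : nbrs L e t = [set w].
      by apply/esym/eqP; rewrite eqEcard sub1set wt' cards1 -/(d t) dt.
    rewrite nt big_set1 dt in zt; split=> //; nra.
  have dt : d t = 2%N by have := d2 t tL; rewrite -/(d t); lia.
  have [s [ts ns]] : exists s, s \in L /\ nbrs L e t :\ w = [set s].
    have /cards1P[s es] : #|nbrs L e t :\ w| == 1%N.
      by have := cardsD1 w (nbrs L e t); rewrite wt' -/(d t) dt => /eqP; rewrite add1n eqSS eq_sym.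
    by exists s; split=> //; have := set11 s; rewrite -es !inE => /and3P[].
  rewrite (big_setD1 w wt') /= ns big_set1 dt in zt; have ps := z0 s ts.
  (* The equation at w reads (T - 1) z w = 1 + z t, so (T - 2) z w = 1 + z t - z w, which exceeds 1
     exactly when z w < z t. *)
  have tw : z w < z t by rewrite ltNge; apply/negP=> le; nra.
  have lt1 : 1 < (T - 2) * ((2 - 1%:R) * z w) by lra.
  split=> [|le1]; first exact: ltW lt1.
  by have := lt_le_trans lt1 le1; rewrite ltxx.
have f1 w : w \in C -> 1 <= f w.
  move=> wC; have wL := CL w wC; have := dC w wC.
  case dw : (d w) => [|[|//]] _; first exact/ltW/f_isolated.
  have /cards1P[t nt] : #|nbrs L e w| == 1%N by rewrite -/(d w) dw.
  by case: (f_end w t wL nt).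
have sumC : \sum_(w <- enum C) f w <= 2.
  rewrite big_enum /=; apply: le_trans Zle; rewrite mulr_sumr.
  rewrite [X in _ <= X](big_setID U) /= -/C lerDr sumr_ge0 // => w.
  rewrite !inE => /andP[wL /andP[_ /eqP->]].
  by rewrite subrr mul0r mulr0.
have even_d := degsum_even L symE irrE.
have noC x y w : nbrs L e x = [set w] -> w \in C -> y \in U -> ~~ e x y.
  move=> nx wC yU; apply/negP=> xy; have : y \in nbrs L e x.
    by rewrite inE xy andbT; move: yU; rewrite inE => /andP[].
  by rewrite nx inE => /eqP yw; move: wC; rewrite inE -yw yU.
(* By [f_end] the only neighbour of w is again deficient, so it can only be t. When [C] has two
   elements, each contributes at least 1 and together at most 2, so both contribute exactly 1. *)
have pair w t : (forall x, x \in C -> x = w \/ x = t) -> w \in C -> f w <= 1 ->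
    nbrs L e w = [set t].
  move=> Cwt wC fw; have wL := CL w wC; have := dC w wC.
  case dw : (d w) => [|[|//]] _; first by have := lt_le_trans (f_isolated w wL dw) fw; rewrite ltxx.
  have /cards1P[s ns] : #|nbrs L e w| == 1%N by rewrite -/(d w) dw.
  have [_ /(_ fw) nw] := f_end w s wL ns.
  have /andP[sL ws] : (s \in L) && e w s by have := set11 s; rewrite -ns inE.
  have sC : s \in C by rewrite !inE sL nw cards1.
  by case: (Cwt s sC) ws ns => -> //; rewrite irrE.
have memC x : (x \in C) = (x \in enum C) by rewrite mem_enum.
have size2 : (size (enum C) <= 2)%N.
  move: sumC memC; case: (enum C) => [|w [|t [|t' s]]] //; rewrite !big_cons => sC memC.
  have [w1 t1 t'1] : [/\ 1 <= f w, 1 <= f t & 1 <= f t'].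
    by split; apply: f1; rewrite memC !inE eqxx ?orbT.
  have : 0 <= \sum_(x <- s) f x.
    rewrite big_seq sumr_ge0 // => x xs; apply: le_trans ler01 (f1 x _).
    by rewrite memC !inE xs !orbT.
  by lra.
exists (enum C); split; [exact: enum_uniq | by move=> x; rewrite mem_enum | by [] | ..].
all: move: size2 (enum_uniq C) sumC memC; case: (enum C) => [|w [|t [|//]]] _ //=.
- by move=> _ _ _ x y; rewrite !inE => /eqP-> /eqP->; rewrite eqxx.
- rewrite inE andbT => wt; rewrite !big_cons big_nil => sC memC.
  have [wC tC] : w \in C /\ t \in C by rewrite !memC !inE !eqxx orbT.
  have := f1 w wC; have := f1 t tC => ft fw.
  have nw : nbrs L e w = [set t].
    by apply: pair => //; [move=> x; rewrite memC !inE => /orP[]/eqP->; auto | lra].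
  have : t \in nbrs L e w by rewrite nw inE.
  rewrite inE => /andP[_ ewt] x y; rewrite !inE => /orP[]/eqP-> /orP[]/eqP-> //.
  - by rewrite eqxx.
  - by rewrite symE.
  - by rewrite eqxx.
- by move=> _ _ memC x y; rewrite memC.
- move=> _ _ memC x y; rewrite memC inE => /eqP-> yU {x}.
  have wC : w \in C by rewrite memC inE.
  have dw0 : d w = 0%N.
    have := dC w wC; move: even_d; rewrite /degsum (big_setID U) /= -/C oddD.
    have -> : C = [set w] by apply/setP=> x; rewrite memC !inE.
    rewrite big_set1 -/(d w) (eq_bigr (fun=> 2%N)) => [|x]; last first.
      by rewrite !inE => /andP[_ /andP[_ /eqP]].
    rewrite sum_nat_const muln2 odd_double /=.
    by case: (d w) => [|[]].
  apply/negP=> wy; have : y \in nbrs L e w.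
    by rewrite inE wy andbT; move: yU; rewrite inE => /andP[].
  by rewrite (cards0_eq dw0) inE.
- rewrite inE andbT => wt; rewrite !big_cons big_nil => sC memC x y.
  have [wC tC] : w \in C /\ t \in C by rewrite !memC !inE !eqxx orbT.
  have := f1 w wC; have := f1 t tC => ft fw.
  have nw : nbrs L e w = [set t].
    by apply: pair => //; [move=> z'; rewrite memC !inE => /orP[]/eqP->; auto | lra].
  have nt : nbrs L e t = [set w].
    by apply: pair => //; [move=> z'; rewrite memC !inE => /orP[]/eqP->; auto | lra].
  by rewrite memC in_cons mem_seq1 => /orP[]/eqP-> yU; [apply: noC nw tC yU | apply: noC nt wC yU].
Qed.

Lemma dominated_nbrs_le2 (n : nat) (e : rel 'I_n) u v w (L := [set: 'I_n] :\ u :\ v) :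
  symmetric e -> irreflexive e -> ~ has_K33 (setT, e) -> u != v ->
  (forall x, x != u -> e u x) -> (forall x, x != v -> e v x) ->
  w \in L -> (#|nbrs L e w| <= 2)%N.
Proof.
move=> symE irrE noK uv Eu Ev; rewrite !inE andbT => /andP[wv wu].
rewrite leqNgt; apply/negP=> big; apply: noK.
apply: (@K33_common_nbrs _ setT e u v w) => //; rewrite ?in_setT //=.
  by rewrite !inE negb_or uv eq_sym wu eq_sym wv.
apply: leq_trans big _; apply/subset_leq_card/subsetP=> t; rewrite !inE !andbT.
by case/andP=> /andP[tv tu] ->; rewrite Eu // Ev.
Qed.

(** The at most two deficient vertices form a clique with no edge to the others and serve as the
    last block; the others are 2-regular among themselves and split into triangles. *)
Lemma dominated_iso (R : rcfType) (n : nat) (e : rel 'I_n) u v (T : R) (z : 'I_n -> R)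
    (L := [set: 'I_n] :\ u :\ v) :
  symmetric e -> irreflexive e -> ~ has_K33 (setT, e) -> u != v ->
  (forall x, x != u -> e u x) -> (forall x, x != v -> e v x) ->
  4 < T -> (forall w, w \in L -> 0 < z w) ->
  (forall w, w \in L -> (T - #|nbrs L e w|%:R) * z w = 1 + \sum_(t in nbrs L e w) z t) ->
  (T - 2) * (\sum_(w in L) (2 - #|nbrs L e w|%:R) * z w) <= 2 ->
  graph_iso e (F33 n).
Proof.
move=> symE irrE noK uv Eu Ev T4 z0 ze Zle.
have inL w : (w \in L) = (w != v) && (w != u) by rewrite !inE andbT.
have d2 w : w \in L -> (#|nbrs L e w| <= 2)%N.
  exact: dominated_nbrs_le2.
have [l [ul lC l2 lE nCU]] := two_factor_remainder symE irrE T4 d2 z0 ze Zle.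
move: lC nCU; set U := [set w in L | _] => lC nCU.
have UL : U \subset L by apply/subsetP=> w; rewrite inE => /andP[].
have UE w : w \in U -> #|nbrs L e w| == 2%N by rewrite inE => /andP[_].
have Ucl x y : x \in U -> y \in L -> e x y -> y \in U.
  move=> xU yL xy; apply/negPn/negP=> nyU.
  have yC : y \in L :\: U by rewrite inE nyU.
  by move/negP: (nCU y x yC xU); rewrite symE.
have tri w : w \in U -> exists a b,
    [/\ a != b, nbrs L e w = [set a; b], e a b, a \in U & b \in U].
  move=> wU; have /cards2P[a [b [ab nw]]] := UE w wU; exists a, b.
  have inU t : t \in nbrs L e w -> t \in U.
    by rewrite inE => /andP[tL wt]; apply: Ucl wU tL wt.
  split=> //; last 2 first; [by rewrite inU ?nw ?set21 | by rewrite inU ?nw ?set22 |].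
  apply: (two_regular_triangles symE irrE noK _ _ uv _ _ UL Ucl _ wU ab nw) => //.
  - by move=> x _; apply: Eu.
  - by move=> x _; apply: Ev.
  - by move=> x /UE/eqP.
have [l' tl] := triangle_listing_ext symE irrE UL tri
  (triangle_listing_small irrE ul lC (leqW l2) lE).
apply: (F33_iso symE irrE uv Eu Ev (l := l')).
by have -> : [set~ u] :\ v = L by apply/setP=> x; rewrite inL !inE.
Qed.

(* Pairing the eigenvector with the all-ones vector on the non-dominating
   vertices turns the bound on [l] into a bound on the total weighted deficiency
   2 - deg of these vertices. *)
Lemma eigen_dominated_iso (R : rcfType) (n : nat) (e : rel 'I_n) u v (l : R) (x : 'I_n -> R) :
  symmetric e -> irreflexive e -> ~ has_K33 (setT, e) -> u != v ->
  (forall x, x != u -> e u x) -> (forall x, x != v -> e v x) ->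
  (4 < n)%N -> n%:R + 2 < l ->
  2 * (n%:R - 2) * (l - 4) <= (l - n%:R) * (l - 6) * (l - 4) + 8 ->
  signless_eigen e l x -> (exists i, x i != 0) -> graph_iso e (F33 n).
Proof.
move=> symE irrE noK uv Eu Ev n4 nl excess xl [i0 xi0].
have nR : (5%:R : R) <= n%:R by rewrite ler_nat.
pose L := [set: 'I_n] :\ u :\ v.
have inL w : (w \in L) = (w != v) && (w != u) by rewrite !inE andbT.
have sumL (F : 'I_n -> R) : \sum_i F i = F u + F v + \sum_(i in L) F i.
  rewrite (bigD1 u) //= (bigD1 v) 1?eq_sym //= addrA; congr (_ + _).
  by apply: eq_bigl => i; rewrite inL andbC.
have nbrL w (F : 'I_n -> R) : w \in L ->
    \sum_(t | e w t) F t = F u + F v + \sum_(t in nbrs L e w) F t.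
  rewrite inL => /andP[wv wu]; rewrite big_mkcond sumL symE Eu // symE Ev //.
  by rewrite -big_mkcondr; congr (_ + _); apply: eq_bigl => t; rewrite [RHS]inE.
have nbru (F : 'I_n -> R) : \sum_(t | e u t) F t = F v + \sum_(t in L) F t.
  rewrite big_mkcond sumL irrE add0r Eu 1?eq_sym //; congr (_ + _).
  by apply: eq_bigr => t; rewrite inL => /andP[_ tu]; rewrite Eu.
have nbrv (F : 'I_n -> R) : \sum_(t | e v t) F t = F u + \sum_(t in L) F t.
  rewrite big_mkcond sumL irrE addr0 Ev //; congr (_ + _).
  by apply: eq_bigr => t; rewrite inL => /andP[tv _]; rewrite Ev.
have cL : \sum_(t in L) 1 = n%:R - 2 :> R.
  have := sumL (fun=> 1); rewrite sumr_const card_ord => ->; ring.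
have degL w : w \in L -> (deg e w)%:R = 2 + #|nbrs L e w|%:R :> R.
  by move=> wL; rewrite deg_natr nbrL // sumr_const.
pose d w : R := #|nbrs L e w|%:R.
have eqL w : w \in L -> (l - 2 - d w) * x w = x u + x v + \sum_(t in nbrs L e w) x t.
  move=> wL; have := xl w; rewrite degL // nbrL // => H.
  by rewrite -[d w]/(#|nbrs L e w|%:R); lra.
have equ : l * x u = (n%:R - 1) * x u + x v + \sum_(t in L) x t.
  by have := xl u; rewrite deg_natr !nbru cL => ->; ring.
have eqv : l * x v = (n%:R - 1) * x v + x u + \sum_(t in L) x t.
  by have := xl v; rewrite deg_natr !nbrv cL => ->; ring.
have xuv : x u = x v.
  have : (l - n%:R + 2) * (x u - x v) = 0 by lra.
  by move/eqP; rewrite mulf_eq0 => /orP[|]; [lra | rewrite subr_eq0 => /eqP].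
have d2 w : w \in L -> d w <= 2.
  by move=> wL; rewrite /d (ler_nat R _ 2); apply: dominated_nbrs_le2.
have dE w (c : R) : \sum_(t in nbrs L e w) c = d w * c.
  by rewrite sumr_const /d mulr_natl.
have nbr_in w t : t \in nbrs L e w -> t \in L by rewrite inE => /andP[].
(* If x vanished at u and v, a vertex w of [L] with |x w| maximal would give (l - 2 - d w) |x w| <=
   d w |x w| with d w <= 2, which forces x = 0 since l > 6. *)
pose a := x u; have a0 : a != 0.
  apply: contra_neq xi0 => a0.
  have xu : x u = 0 by []. have xv : x v = 0 by rewrite -xuv.
  have [w0 w0L|] := pickP (mem L); last first.
    move=> L0; have := inL i0; rewrite -[_ \in _]/(mem L i0) L0.
    by case: eqP => [->|_] //; case: eqP => [->|_].
  have [w wL wmax] := @arg_maxP _ _ _ w0 (mem L) (fun w => `|x w|) w0L.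
  have : (l - 2 - d w) * `|x w| <= d w * `|x w|.
    rewrite -[X in X * _]ger0_norm; last by have := d2 w wL; lra.
    rewrite -normrM eqL // xu xv !add0r -dE; apply: le_trans (ler_norm_sum _ _ _) _.
    by apply: ler_sum => t /nbr_in tL; apply: wmax.
  have xw0 : `|x w| <= 0 -> x i0 = 0.
    move=> xw; have [iL|] := boolP (i0 \in L).
      by apply/eqP; rewrite -normr_le0; apply: le_trans (wmax i0 iL) xw.
    by rewrite inL negb_and !negbK => /orP[]/eqP->.
  move=> le1; apply: xw0; have dw := d2 w wL.
  have : 0 <= (l - 6) * `|x w| by rewrite mulr_ge0 //; lra.
  have : 0 <= (2 - d w) * `|x w| by rewrite mulr_ge0 //; lra.
  nra.
(* The divisor x u + x v = 2 a turns the contribution of u and v into the constant 1. *)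
pose z w := x w / (2 * a).
have a20 : 2 * a != 0 by rewrite mulf_neq0 // pnatr_eq0.
have zeq w : w \in L -> (l - 2 - d w) * z w = 1 + \sum_(t in nbrs L e w) z t.
  move=> wL; rewrite /z mulrA eqL // -xuv -/a mulrDl -mulr_suml; congr (_ + _).
  by rewrite -[a + a]mulr2n -[a *+ 2]mulr_natl divff.
(* Minimum principle: at a minimum m of z on [L], (l - 2 - 2 d m) z m >= 1 with a positive
   factor. *)
have z_gt0 w : w \in L -> 0 < z w.
  move=> wL; have [m mL mmin] := @arg_minP _ _ _ w (mem L) z wL.
  apply: lt_le_trans (mmin w wL); have := zeq m mL; have := d2 m mL.
  have : d m * z m <= \sum_(t in nbrs L e m) z t.
    by rewrite -dE; apply: ler_sum => t /nbr_in; apply: mmin.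
  move=> H1 dm H2; have : 1 <= (l - 2 - 2 * d m) * z m by lra.
  move=> H3; rewrite ltNge; apply/negP=> zm.
  have : 0 <= (l - 2 - 2 * d m) * (- z m) by rewrite mulr_ge0 //; lra.
  lra.
have sumz : \sum_(t in L) z t = (l - n%:R) / 2.
  rewrite /z -mulr_suml; have -> : \sum_(t in L) x t = (l - n%:R) * a by move: equ; rewrite -xuv -/a; lra.
  by field.
have total : (l - 2) * (\sum_(t in L) z t) = n%:R - 2 + 2 * \sum_(w in L) d w * z w.
  have : \sum_(w in L) (l - 2 - d w) * z w = \sum_(w in L) (1 + \sum_(t in nbrs L e w) z t).
    by apply: eq_bigr => w; apply: zeq.
  under eq_bigr => w _ do rewrite mulrBl.
  rewrite sumrB -mulr_sumr big_split /= cL.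
  have -> : \sum_(w in L) \sum_(t in nbrs L e w) z t = \sum_(w in L) d w * z w.
    rewrite (exchange_big_dep (mem L)) /= => [|w t _ /nbr_in //].
    apply: eq_bigr => t tL; rewrite -dE; apply: eq_bigl => w.
    have mem_nbrs a1 a2 : (a1 \in nbrs L e a2) = (a1 \in L) && e a2 a1 by rewrite inE.
    have {}tL : t \in L by [].
    by rewrite !mem_nbrs tL symE.
  lra.
apply: (@dominated_iso R n e u v (l - 2) z) => //; first by lra.
rewrite -/L; under eq_bigr => w _ do rewrite mulrBl.
rewrite sumrB -mulr_sumr /=; move: total; rewrite sumz /d.
move: (\sum_(w in L) _) => D total.
(* Now 4 (l - 4) times the deficiency (l - n) - D equals 2 (n - 2)(l - 4) - (l - n)(l - 6)(l - 4),
   which is at most 8 by [excess]. *)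
have -> : D = ((l - 2) * ((l - n%:R) / 2) - (n%:R - 2)) / 2 by lra.
lra.
Qed.

(** * Comparison with the extremal graph *)

Lemma large_eigen_iso (R : rcfType) (n : nat) (e : rel 'I_n) (l : R) (x : 'I_n -> R) :
  (1186 <= n)%N -> symmetric e -> irreflexive e -> ~ has_K33 (setT, e) ->
  n%:R + 2 < l ->
  2 * (n%:R - 2) * (l - 4) <= (l - n%:R) * (l - 6) * (l - 4) + 8 ->
  signless_eigen e l x -> (exists i, x i != 0) -> graph_iso e (F33 n).
Proof.
move=> n1 symE irrE noK nl excess xl [i0 xi0].
have [v _ vmax] := @arg_maxP _ _ _ i0 predT (fun i => `|x i|) isT.
have xv : 0 < `|x v| by apply: lt_le_trans (vmax i0 isT); rewrite normr_gt0.
have [|||||i||w|u [uv Eu Ev]] := @two_dominating R n e l (fun i => `|x i| / `|x v|) v => //.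
- by rewrite divr_ge0 //= ler_pdivrMr // mul1r; apply: vmax.
- by rewrite divff // gt_eqF.
(* Since l exceeds every degree, (l - d(w)) |x w| is the absolute value of the sum of x over the
   neighbours of w. *)
- rewrite -mulr_suml !mulrA -mulrDl ler_pM2r ?invr_gt0 // -lerBlDl -mulrBl.
  have dn := deg_lt w irrE; rewrite -(ltr_nat R) in dn.
  rewrite -[X in X * _]ger0_norm; last by lra.
  rewrite -normrM mulrBl xl addrAC subrr add0r.
  exact: ler_norm_sum.
apply: (eigen_dominated_iso symE irrE noK uv Eu Ev _ nl excess xl) => //; first lia.
by exists i0.
Qed.

Theorem theorem1p4 (R : realType) (n : nat) (e : rel 'I_n) :
  (1186 <= n)%N -> simple_graph e -> ~ is_minor K33 e ->
  q_index R e <= q_index R (F33 n) /\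
  (q_index R e = q_index R (F33 n) <-> graph_iso e (F33 n)) /\
  (let r := ((n - 2) %% 3)%N in
   cubicF n r (q_index R (F33 n)) = 0 /\
   forall x : R, cubicF n r x = 0 -> x <= q_index R (F33 n)).
Proof.
move=> n1 [symE irrE] noK.
have [p [r [r3 p2 en]]] : exists p r, [/\ (r < 3)%N, (2 < p)%N & n = (3 * p + r).+2].
  by exists ((n - 2) %/ 3)%N, ((n - 2) %% 3)%N; split; lia.
subst n; have -> : (((3 * p + r).+2 - 2) %% 3 = r)%N by lia.
have [rho nrho rho0] := cubicF_root R r3 p2.
have F33_simple : symmetric (F33 (3 * p + r).+2).
  move=> i j; rewrite /F33 eq_sym (eq_sym (_ %/ 3)%N); congr (_ && _).
  by rewrite orbCA.
have F33_refl : graph_iso (F33 (3 * p + r).+2) (F33 (3 * p + r).+2).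
  by exists 1%g => i j; rewrite !perm1.
have qF := q_index_F33 r3 p2 nrho rho0 F33_simple F33_refl.
have n6 : (1186%:R : R) <= (3 * p + r).+2%:R by rewrite ler_nat.
have iso : rho <= q_index R e -> graph_iso e (F33 (3 * p + r).+2).
  move=> le_q; set l := q_index R e in le_q *.
  have l0 : 0 < q_index R e by rewrite -/l; lra.
  have /(signless_rootP _ symE)[x xl x0] := q_index_root l0.
  apply: (@large_eigen_iso R _ e l x) => //; first by rewrite -/l; lra.
  have c0 : 0 <= cubicF (3 * p + r).+2 r l by apply: cubicF_ge0 le_q rho0 => //; lra.
  have := cubicF_ge0_excess r3 _ c0; rewrite -/l.
  have -> : (3 * p + r).+2%:R - 2 = (3 * p + r)%:R :> R by rewrite -addn2 natrD addrK.
  by apply; lra.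
have q_iso : graph_iso e (F33 (3 * p + r).+2) -> q_index R e = rho.
  exact: q_index_F33.
rewrite qF; split; last split; last split => // x x0.
- by rewrite leNgt; apply/negP=> lt; have := q_iso (iso (ltW lt)); lra.
- by split=> [eq|/q_iso //]; apply: iso; rewrite eq.
(* A root above n + 2 is itself the index of [F33] by [q_index_F33]; any other root is below rho. *)
have [le|lt] := leP x ((3 * p + r).+2%:R + 2); first exact: le_trans le (ltW nrho).
by rewrite -qF (q_index_F33 r3 p2 lt x0 F33_simple F33_refl).
Qed.
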